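(* Let $T\in{\rm Aut}(X,\mathcal B,\mu)$ be ergodic with measure-theoretic entropy $h(T)>0$. Then the topological entropy of the topological lens $(C_2(\mu),\widetilde T)$ is $+\infty$.
   Context: $C_2(\mu)$: probability measures on $X\times X$ with both marginals $\mu$, with the compact metrizable topology $\rho_n\to\rho$ iff $\rho_n(A\times B)\to\rho(A\times B)$ for all measurable $A,B$; the topological lens is $\widetilde T(\rho)(A\times B)=\rho(T^{-1}A\times T^{-1}B)$. *)

(* Defs.v *)
From HB Require Import structures.
From mathcomp Require Import all_boot all_order all_algebra.
From mathcomp Require Import all_classical all_reals all_analysis.
Set Implicit Arguments. Unset Strict Implicit. Unset Printing Implicit Defensive.
Import Order.TTheory GRing.Theory Num.Theory.
Import numFieldNormedType.Exports.
Local Open Scope classical_set_scope.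
Local Open Scope ring_scope.

(* ---------- Topological entropy (Adler-Konheim-McAndrew, via open covers)
   of a map phi on a subspace S of a type P, where P carries the initial
   (weak) topology generated by the real functions f i, i in J.          *)
Section TopEntropy.
Variables (R : realType) (I P : Type).
Variables (J : set I) (f : I -> P -> R) (S : set P) (phi : P -> P).

Definition rel_initial_open (U : set P) : Prop :=
  U `<=` S /\
  forall p, U p -> exists (k : nat) (g : 'I_k -> I) (e : R),
    0 < e /\ (forall j, J (g j)) /\
    forall q, S q -> (forall j, `|f (g j) q - f (g j) p| < e) -> U q.

Definition open_cover (k : nat) (U : 'I_k -> set P) : Prop :=
  (forall i, rel_initial_open (U i)) /\ (forall p, S p -> exists i, U i p).

Definition join_cell (k n : nat) (U : 'I_k -> set P) (w : {ffun 'I_n -> 'I_k}) : set P :=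
  [set p | forall j : 'I_n, U (w j) (iter j phi p)].

Definition cover_number (k : nat) (U : 'I_k -> set P) (n : nat) : nat :=
  \big[minn/#|{ffun 'I_n -> 'I_k}|]_(A : {set {ffun 'I_n -> 'I_k}} |
      `[< forall p, S p -> exists2 w, w \in A & join_cell U w p >]) #|A|.

Definition cover_entropy (k : nat) (U : 'I_k -> set P) : R :=
  limn (fun n : nat => ln ((cover_number U n.+1)%:R) / (n.+1)%:R).

Definition top_entropy : \bar R :=
  ereal_sup [set x | exists (k : nat) (U : 'I_k -> set P),
                       open_cover U /\ x = (cover_entropy U)%:E].
End TopEntropy.

Section KSEntropy.
Variables (R : realType) (d : measure_display) (X : measurableType d).
Variables (mu : probability X R) (T : X -> X).

Definition xlnx (x : R) : R := if x == 0 then 0 else x * ln x.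

Definition meas_partition (k : nat) (Q : 'I_k -> set X) : Prop :=
  (forall i, measurable (Q i)) /\
  (forall i j, i != j -> Q i `&` Q j = set0) /\
  (forall x, exists i, Q i x).

Definition part_join (k n : nat) (Q : 'I_k -> set X) (w : {ffun 'I_n -> 'I_k}) : set X :=
  [set x | forall j : 'I_n, Q (w j) (iter j T x)].

Definition join_entropy (k : nat) (Q : 'I_k -> set X) (n : nat) : R :=
  - \sum_(w : {ffun 'I_n -> 'I_k}) xlnx (fine (mu (part_join Q w))).

Definition ks_entropy_part (k : nat) (Q : 'I_k -> set X) : R :=
  limn (fun n : nat => join_entropy Q n.+1 / (n.+1)%:R).

Definition ks_entropy : \bar R :=
  ereal_sup [set x | exists (k : nat) (Q : 'I_k -> set X),
                       meas_partition Q /\ x = (ks_entropy_part Q)%:E].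

Definition is_aut : Prop :=
  bijective T /\ measurable_fun setT T /\
  (forall A, measurable A -> measurable (T @` A)) /\
  (forall A, measurable A -> mu (T @^-1` A) = mu A).

Definition ergodic : Prop :=
  forall A, measurable A -> T @^-1` A = A -> mu A = 0%E \/ mu A = 1%E.

Definition couplings : set (set (X * X)%type -> \bar R) :=
  [set rho | exists m : probability (X * X)%type R,
     rho = (m : set (X * X)%type -> \bar R) /\
     forall A, measurable A -> m (A `*` setT) = mu A /\ m (setT `*` A) = mu A].

Definition lens_map (rho : set (X * X)%type -> \bar R) : set (X * X)%type -> \bar R :=
  fun E => rho ((fun z : X * X => (T z.1, T z.2)) @^-1` E).

(* coordinate functions rho |-> rho(A x B), A, B measurable, which generate
   the topology of C_2(mu) *)
Definition coord_index : set (set X * set X) :=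
  [set AB | measurable AB.1 /\ measurable AB.2].
Definition coupling_coord (AB : set X * set X) (rho : set (X * X)%type -> \bar R) : R :=
  fine (rho (AB.1 `*` AB.2)).
End KSEntropy.

(* standard Borel space: Borel-isomorphic to a Borel subset of R *)
Definition standard_borel (R : realType) (d : measure_display) (X : measurableType d) : Prop :=
  exists f : X -> R, injective f /\ measurable_fun setT f /\
    forall A, measurable A -> measurable (f @` A).

(* Main.v *)
Require Import Defs.
From HB Require Import structures.
From mathcomp Require Import all_boot all_order all_algebra.
From mathcomp Require Import all_classical all_reals all_analysis.
From mathcomp Require Import ring lra zify.
Set Implicit Arguments. Unset Strict Implicit. Unset Printing Implicit Defensive.
Import Order.TTheory GRing.Theory Num.Theory.
Import numFieldNormedType.Exports.
Local Open Scope classical_set_scope.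
Local Open Scope ring_scope.

(** Fix a finite partition of positive entropy and read off names of points.
    Some cell has an indicator [g], normalised to values +1 and -1, whose
    conditional variance given any finite past stays above some [v > 0].
    With [d_j] the deviation of [g o T^(L+j)] from its conditional mean given
    the first [L+j] letters, the Riesz products
      prod_(j < n) (1 + s_j(y_j .. y_(j+L-1)) d_j(x) d_j(y) / 4)
    are densities of self-couplings of [mu], because the [d_j] are martingale
    differences; here [s_j] is an arbitrary sign function on words of length [L].

    Averaging over all sign choices [s], the correlation of the [s]-coupling
    with its own sign pattern is at least [n v^2 / 4], whereas for one fixed
    coupling the exponential moment, with parameter [lam], of the correlation
    with a random sign pattern is at most [exp (2 n lam^2 max_w mu[w])], where
    [w] runs over words of length [L]. Hence a cover by sets on which the
    correlations are almost constant needs at least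
    [exp (n (lam v^2 / 8 - 2 lam^2 max_w mu[w]))] cells at time [n]. By
    ergodicity and positive entropy [max_w mu[w]] tends to 0 as [L] grows, so
    choosing [lam] large and then [L] large makes the entropy arbitrarily large. *)

(** * Sums over words *)

Section WordSums.
Variables (R : realType) (A : finType).
Implicit Types (F G : seq A -> R) (w : seq A).

(** The sum runs over tuples, but [F] takes plain sequences, so that words of different lengths can
    be compared without casts. *)
Definition wsum n F : R := \sum_(w : n.-tuple A) F w.

Lemma eq_wsum n F G : (forall w, size w = n -> F w = G w) -> wsum n F = wsum n G.
Proof. by move=> FG; apply: eq_bigr => w _; apply: FG; rewrite size_tuple. Qed.

Lemma ler_wsum n F G : (forall w, size w = n -> F w <= G w) -> wsum n F <= wsum n G.
Proof. by move=> FG; apply: ler_sum => w _; apply: FG; rewrite size_tuple. Qed.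

Lemma wsum_ge0 n F : (forall w, size w = n -> 0 <= F w) -> 0 <= wsum n F.
Proof. by move=> FG; apply: sumr_ge0 => w _; apply: FG; rewrite size_tuple. Qed.

Lemma wsumD n F G : wsum n (fun w => F w + G w) = wsum n F + wsum n G.
Proof. exact: big_split. Qed.

Lemma wsumN n F : wsum n (fun w => - F w) = - wsum n F.
Proof. exact: sumrN. Qed.

Lemma wsumZ n c F : wsum n (fun w => c * F w) = c * wsum n F.
Proof. by rewrite /wsum mulr_sumr. Qed.

Lemma wsum_exchange (I : finType) n (F : I -> seq A -> R) :
  \sum_i wsum n (F i) = wsum n (fun w => \sum_i F i w).
Proof. exact: exchange_big. Qed.

Lemma wsum0 F : wsum 0 F = F [::].
Proof.
rewrite /wsum (big_pred1 [tuple]) //= => t; apply/esym/eqP; exact: tuple0.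
Qed.

Lemma wsumS_cons n F : wsum n.+1 F = wsum n (fun w => \sum_a F (a :: w)).
Proof.
rewrite /wsum exchange_big /=.
rewrite pair_big /= (reindex (fun q : A * n.-tuple A => [tuple of q.1 :: q.2])) //=.
exists (fun t : n.+1.-tuple A => (thead t, [tuple of behead t])).
  by case=> a t _; congr (_, _); apply/val_inj.
by move=> t _; rewrite [in RHS](tuple_eta t); apply/val_inj.
Qed.

Lemma wsumS_rcons n F : wsum n.+1 F = wsum n (fun w => \sum_a F (rcons w a)).
Proof.
elim: n F => [|n IH] F; first by rewrite wsumS_cons !wsum0.
rewrite wsumS_cons [RHS]wsumS_cons IH; apply: eq_wsum => w _.
by rewrite exchange_big; apply: eq_bigr.
Qed.

End WordSums.

(** * Bounding one entropy term by a variance term *)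

Section Entropy1.
Variable R : realType.
Implicit Types (x q e : R).

Lemma entropy_term_ge0 x q : 0 <= q -> q <= x -> 0 <= q * ln x - xlnx q.
Proof.
move=> q0 qx; rewrite /xlnx; case: eqP => [->|/eqP qn0]; first by rewrite mul0r subrr.
have qp : 0 < q by rewrite lt_neqAle eq_sym qn0.
by rewrite -mulrBr mulr_ge0// subr_ge0 ler_ln ?posrE// (lt_le_trans qp).
Qed.

(** With [r = q / x], divide by [x]. If [r >= e ^+ 2], then [- r ln r <= 1 - r], which is at most
    the variance term. Otherwise [- r ln r <= 2 sqrt r < 2 e]. Small conditional variance thus
    forces small conditional entropy. *)
Lemma entropy_term_le x q e : 0 < e -> 0 <= q -> q <= x ->
  q * ln x - xlnx q <= 2 * e * x + q * (1 - q / x) / e ^+ 2.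
Proof.
move=> e0 q0 qx; rewrite /xlnx; case: eqP => [->|/eqP qn0].
  by rewrite !mul0r subrr addr0 mulr_ge0 ?mulr_ge0// ?(le_trans q0 qx)// ltW.
have qp : 0 < q by rewrite lt_neqAle eq_sym qn0.
have xp : 0 < x by exact: lt_le_trans qx.
set r := q / x.
have rp : 0 < r by rewrite divr_gt0.
have r1 : r <= 1 by rewrite ler_pdivrMr// mul1r.
have qE : q = r * x by rewrite /r -mulrA mulVf ?mulr1// gt_eqF.
have -> : q * ln x - q * ln q = x * (- (r * ln r)).
  by rewrite {2}/r ln_div ?posrE// mulrN mulrA (mulrC x) -qE; ring.
rewrite [X in _ <= _ + X](_ : _ = x * (r * (1 - r) / e ^+ 2)); last first.
  by rewrite {1}qE; ring.
rewrite (mulrC _ x) -mulrDr ler_pM2l//.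
have e2 : 0 < e ^+ 2 by rewrite exprn_gt0.
have t0 : 0 <= r * (1 - r) / e ^+ 2.
  by apply: divr_ge0 (ltW e2); rewrite mulr_ge0 ?subr_ge0// ltW.
have lnr (z : R) : 0 < z -> - ln z <= z^-1 - 1.
  move=> z0; rewrite -lnV ?posrE//.
  have := @le_ln1Dx R (z^-1 - 1); rewrite addrCA subrr addr0; apply.
  by rewrite ltrBDr addrC subrr invr_gt0.
case: (leP (e ^+ 2) r) => re.
  have H : - (r * ln r) <= 1 - r.
    rewrite -mulrN (le_trans (ler_wpM2l (ltW rp) (lnr _ rp)))//.
    by rewrite mulrBr mulfV ?gt_eqF// mulr1.
  have : 1 - r <= r * (1 - r) / e ^+ 2.
    rewrite ler_pdivlMr// mulrC ler_wpM2r// subr_ge0//.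
  by lra.
(* For small [r], the bound [lnr] is applied to [sqrt r], using [ln r = 2 ln (sqrt r)]. *)
have sr : 0 < Num.sqrt r by rewrite sqrtr_gt0.
have rE : r = Num.sqrt r ^+ 2 by rewrite sqr_sqrtr// ltW.
have : - (r * ln r) <= 2 * Num.sqrt r.
  rewrite {2}rE lnXn// -mulrN.
  have := lnr _ sr => H.
  have : r * - (ln (Num.sqrt r) *+ 2) <= r * (2 * ((Num.sqrt r)^-1 - 1)).
    rewrite ler_wpM2l ?(ltW rp)//; rewrite -mulr_natl; lra.
  move=> /le_trans; apply.
  rewrite {1}rE mulrCA ler_wpM2l// mulrBr expr2 -mulrA mulfV ?gt_eqF// mulr1.
  by rewrite mulr1 gerBl mulr_ge0// ltW.
have : Num.sqrt r <= e.
  rewrite -(ler_pXn2r (n := 2))// ?nnegrE ?ltW// -rE //.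
lra.
Qed.

End Entropy1.

(** * Entropy and conditional variance of a stationary word process *)

Section WordProcess.
Variables (R : realType) (A : finType) (p : seq A -> R).
Hypothesis p_ge0 : forall w, 0 <= p w.
Hypothesis p_nil : p [::] = 1.
Hypothesis p_rcons : forall w, \sum_a p (rcons w a) = p w.
Hypothesis p_cons : forall w, \sum_a p (a :: w) = p w.

Lemma p_rcons_le w a : p (rcons w a) <= p w.
Proof. by rewrite -(p_rcons w) (bigD1 a)//= lerDl sumr_ge0. Qed.

Lemma wsum_p n : wsum n p = 1.
Proof.
elim: n => [|n IH]; first by rewrite wsum0.
by rewrite wsumS_cons -IH; apply: eq_wsum => w _; rewrite p_cons.
Qed.

Section Sign.
Variable g : A -> R.
Hypothesis g2 : forall a, g a ^+ 2 = 1.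

Definition csum w := \sum_a g a * p (rcons w a).
(** Conditional mean of [g] at the next letter given the past [w], equal to 0 on null words. As [g]
    squares to 1, [1 - cmean w ^+ 2] is the conditional variance and [cvar n] its expectation. *)
Definition cmean w := csum w / p w.
Definition cvar n := wsum n (fun w => p w * (1 - cmean w ^+ 2)).

Lemma norm_g a : `|g a| = 1.
Proof. by apply/eqP; rewrite -sqrp_eq1// real_normK ?num_real// g2. Qed.

Lemma csum_norm w : `|csum w| <= p w.
Proof.
rewrite (le_trans (ler_norm_sum _ _ _))// -p_rcons ler_sum// => a _.
by rewrite normrM norm_g mul1r ger0_norm.
Qed.

Lemma cmeanM w : cmean w * p w = csum w.
Proof.
rewrite /cmean; have [p0|pn0] := eqVneq (p w) 0; last by rewrite divfK.
by rewrite p0 mulr0; apply/esym/eqP; rewrite -normr_le0 (le_trans (csum_norm w))// p0.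
Qed.

Lemma cmean_norm w : `|cmean w| <= 1.
Proof.
have [p0|pn0] := eqVneq (p w) 0; first by rewrite /cmean p0 invr0 mulr0 normr0.
have pp : 0 < p w by rewrite lt_neqAle eq_sym pn0 p_ge0.
by rewrite normrM normfV (ger0_norm (p_ge0 w)) ler_pdivrMr// mul1r csum_norm.
Qed.

(** The martingale difference property, from which the marginals of the Riesz products follow. *)
Lemma dev_centered w : \sum_a p (rcons w a) * (g a - cmean w) = 0.
Proof.
under eq_bigr do rewrite mulrBr.
rewrite big_split /= sumrN -mulr_suml p_rcons mulrC cmeanM.
by under eq_bigr do rewrite mulrC; rewrite subrr.
Qed.

Lemma dev_corr w :
  \sum_a p (rcons w a) * (g a * (g a - cmean w)) = p w * (1 - cmean w ^+ 2).
Proof.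
under eq_bigr => a _.
  rewrite (_ : _ * _ = p (rcons w a) - cmean w * (g a * p (rcons w a))); last first.
    by rewrite mulrBr -expr2 g2; ring.
  over.
rewrite big_split /= p_rcons sumrN -mulr_sumr -/(csum w) -cmeanM; ring.
Qed.

(* Cauchy-Schwarz: conditioning on one more letter of the past can only
   decrease the conditional variance. *)
Lemma cvarS n : cvar n.+1 <= cvar n.
Proof.
rewrite /cvar wsumS_cons; apply: ler_wsum => w _.
have csumE : csum w = \sum_a csum (a :: w).
  rewrite /csum exchange_big /=; apply: eq_bigr => b _.
  by rewrite -mulr_sumr -p_cons.
set m := cmean w.
apply: (@le_trans _ _ (\sum_a (p (a :: w) * (1 + m ^+ 2) - 2 * m * csum (a :: w)))).
  apply: ler_sum => a _; rewrite -cmeanM.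
  have -> : p (a :: w) * (1 + m ^+ 2) - 2 * m * (cmean (a :: w) * p (a :: w)) =
     p (a :: w) * (1 - cmean (a :: w) ^+ 2) + p (a :: w) * (m - cmean (a :: w)) ^+ 2.
    by ring.
  by rewrite lerDl mulr_ge0// sqr_ge0.
rewrite big_split /= sumrN -mulr_suml -mulr_sumr -csumE p_cons -cmeanM -/m.
by rewrite le_eqVlt; apply/orP; left; apply/eqP; ring.
Qed.

Lemma cvar_noninc n m : (n <= m)%N -> cvar m <= cvar n.
Proof.
move=> /subnK <-; elim: (m - n)%N => // l IH.
by rewrite addSn (le_trans (cvarS _)).
Qed.

End Sign.

Definition pm1 (i a : A) : R := if a == i then 1 else -1.

Lemma pm1_sqr i a : pm1 i a ^+ 2 = 1.
Proof. by rewrite /pm1; case: ifP => _; rewrite ?sqrrN expr1n. Qed.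

Definition wentropy n : R := - wsum n (fun w => xlnx (p w)).

Lemma xlnx_sum w : xlnx (p w) = \sum_a p (rcons w a) * ln (p w).
Proof. by rewrite -mulr_suml p_rcons /xlnx; case: eqP => // ->; rewrite mul0r. Qed.

(** Chain rule: the increment is the conditional entropy of the next letter given the first [n]. *)
Lemma wentropyS n : wentropy n.+1 - wentropy n =
  wsum n (fun w => \sum_a (p (rcons w a) * ln (p w) - xlnx (p (rcons w a)))).
Proof.
rewrite /wentropy opprK wsumS_rcons -wsumN -wsumD; apply: eq_wsum => w _.
by rewrite xlnx_sum -sumrN addrC -big_split.
Qed.

(** If [q] is the conditional probability of [i], the conditional mean is [2 q - 1], and
    [1 - (2 q - 1)^2 = 4 q (1 - q)]. *)
Lemma cvar_pm1 i n : cvar (pm1 i) n =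
  4 * wsum n (fun w => p (rcons w i) * (1 - p (rcons w i) / p w)).
Proof.
rewrite -wsumZ; apply: eq_wsum => w _.
have [p0|pn0] := eqVneq (p w) 0.
  have -> : p (rcons w i) = 0.
    by apply/eqP; rewrite eq_le p_ge0 -p0 p_rcons_le.
  by rewrite p0 !mul0r mulr0.
have csE : csum (pm1 i) w = 2 * p (rcons w i) - p w.
  rewrite /csum (bigD1 i)//= -(p_rcons w) [in RHS](bigD1 i)//= /pm1 eqxx mul1r.
  rewrite (eq_bigr (fun a => - p (rcons w a))); last first.
    by move=> a ai; rewrite (negbTE ai) mulN1r.
  by rewrite sumrN; ring.
by rewrite /cmean csE; field.
Qed.

Lemma wentropy_incr_ge0 n : 0 <= wentropy n.+1 - wentropy n.
Proof.
rewrite wentropyS; apply: wsum_ge0 => w _; apply: sumr_ge0 => a _.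
exact: entropy_term_ge0 (p_ge0 _) (p_rcons_le _ _).
Qed.

Lemma wentropy_incr_le n e : 0 < e -> wentropy n.+1 - wentropy n <=
  2 * e * #|A|%:R + (\sum_a cvar (pm1 a) n) / (4 * e ^+ 2).
Proof.
move=> e0; rewrite wentropyS.
apply: (@le_trans _ _ (wsum n (fun w => \sum_a (2 * e * p w +
    p (rcons w a) * (1 - p (rcons w a) / p w) / e ^+ 2)))).
  apply: ler_wsum => w _; apply: ler_sum => a _.
  exact: entropy_term_le (p_ge0 _) (p_rcons_le _ _).
rewrite -wsum_exchange.
under eq_bigr => a _.
  rewrite wsumD wsumZ wsum_p mulr1.
  under eq_wsum do rewrite mulrC.
  rewrite wsumZ.
  over.
rewrite big_split /= sumr_const -[(2 * e) *+ _]mulr_natr lerD2l mulr_suml.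
rewrite le_eqVlt; apply/orP; left; apply/eqP; apply: eq_bigr => a _.
by rewrite cvar_pm1; field; rewrite gt_eqF.
Qed.

Lemma wentropy0 : wentropy 0 = 0.
Proof. by rewrite /wentropy wsum0 p_nil /xlnx oner_eq0 ln1 mulr0 oppr0. Qed.

(** The conditional variances do not increase with the past, so once small they stay small. The
    entropy increments then tend to 0, and so do their Cesaro means. *)
Lemma wentropy_mean_cvg0 :
  (forall i e, 0 < e -> exists n, cvar (pm1 i) n < e) ->
  (fun n => wentropy n.+1 / n.+1%:R) @ \oo --> (0 : R).
Proof.
move=> small.
have h0 : (fun n => wentropy n.+1 - wentropy n) @ \oo --> (0 : R).
  apply/cvgrPdist_le => e e0.
  (* The constants give [2 * e1 * K = e / 2] and [e2 * K / (4 * e1 ^+ 2) = e / 4]; the added 1 keeps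
     [K] positive. *)
  pose K : R := #|A|%:R + 1.
  have K0 : 0 < K by rewrite ltr_wpDl.
  pose e1 := e / (4 * K).
  have e10 : 0 < e1 by rewrite divr_gt0// mulr_gt0.
  pose e2 := e * e1 ^+ 2 / K.
  have e20 : 0 < e2 by rewrite divr_gt0// mulr_gt0// exprn_gt0.
  have /choice [N HN] : forall i, exists n, cvar (pm1 i) n < e2.
    by move=> i; exact: small.
  exists (\max_i N i)%N => // n /= le_n.
  rewrite sub0r normrN ger0_norm ?wentropy_incr_ge0//.
  apply: (le_trans (wentropy_incr_le n e10)).
  have S1 : \sum_a cvar (pm1 a) n <= e2 * K.
    apply: (@le_trans _ _ (\sum_(a : A) e2)).
      apply: ler_sum => a _; rewrite (le_trans _ (ltW (HN a)))//.
      by apply: (cvar_noninc (pm1_sqr _)); rewrite (leq_trans _ le_n)// leq_bigmax.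
    by rewrite sumr_const -[e2 *+ _]mulr_natr ler_wpM2l ?(ltW e20)// lerDl.
  have e1sq : 0 < e1 ^+ 2 by rewrite exprn_gt0.
  apply: (@le_trans _ _ (2 * e1 * K + e2 * K / (4 * e1 ^+ 2))).
    apply: lerD; first by rewrite ler_wpM2l ?lerDl// mulr_ge0// ltW.
    by rewrite ler_wpM2r// invr_ge0 mulr_ge0// ltW.
  rewrite [leLHS](_ : _ = e / 2 + e / 4); first by lra.
  by rewrite /e2 /e1; field; rewrite !gt_eqF.
have := cesaro h0.
rewrite /arithmetic_mean /series /= => H.
suff -> : (fun n => wentropy n.+1 / n.+1%:R) =
   (fun n => n.+1%:R^-1 * \sum_(0 <= i < n.+1) (wentropy i.+1 - wentropy i)) by [].
by apply/funext => n; rewrite telescope_sumr// wentropy0 subr0 mulrC.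
Qed.

Lemma cvar_lower_bound : 0 < limn (fun n => wentropy n.+1 / n.+1%:R) ->
  exists i v, 0 < v /\ forall n, v <= cvar (pm1 i) n.
Proof.
move=> lim_gt0; apply: contrapT => H.
suff /cvg_lim lim0 : (fun n => wentropy n.+1 / n.+1%:R) @ \oo --> (0 : R).
  by move: lim_gt0; rewrite lim0// ltxx.
apply: wentropy_mean_cvg0 => i e e0.
apply: contrapT => /forallNP nex; apply: H; exists i, e; split => // n.
by rewrite leNgt; apply/negP/nex.
Qed.

End WordProcess.

(** * Averages over random signs *)

Section SignSums.
Variables (R : realType) (U : finType).
Implicit Types (b : bool) (x : R).

Definition sgb b : R := (-1) ^+ b.

Lemma norm_sgb b : `|sgb b| = 1.
Proof. by rewrite /sgb normrX normrN1 expr1n. Qed.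

Lemma sgb_sqr b : sgb b * sgb b = 1.
Proof. by rewrite /sgb; case: b; rewrite ?expr0 ?expr1 ?mulrNN mulr1. Qed.

Lemma sum_bool_fun (F : bool -> R) : \sum_b F b = F true + F false.
Proof. by rewrite big_bool. Qed.

Lemma sum_sgb (t : U) : \sum_(tau : {ffun U -> bool}) sgb (tau t) = 0.
Proof.
rewrite (eq_bigr (fun tau : {ffun U -> bool} =>
   \prod_u (if u == t then sgb (tau u) else 1))); last first.
  by move=> tau _; rewrite -big_mkcond big_pred1_eq.
rewrite -(bigA_distr_bigA (fun u b => if u == t then sgb b else 1)) (bigD1 t)//=.
by rewrite eqxx sum_bool_fun /sgb expr1 expr0 addNr mul0r.
Qed.

(** From [expR (- x) >= 1 - x] one gets [expR x <= 1 / (1 - x)], and [(1 - x) (1 + x + 2 x^2) = 1 +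
    x^2 (1 - 2 x) >= 1]. *)
Lemma expR_le_quad x : `|x| <= 1 / 2 -> expR x <= 1 + x + 2 * x ^+ 2.
Proof.
move=> /ler_normlP [x1 x2].
have := expR_ge1Dx (- x) => H.
have xp : 0 < 1 - x by lra.
have : expR x * (1 - x) <= 1.
  by rewrite -[leRHS](expRxMexpNx_1 x) ler_wpM2l// expR_ge0.
rewrite -ler_pdivlMr// => /le_trans; apply.
rewrite ler_pdivrMr//; nra.
Qed.

Lemma expRD_expRN_le x : `|x| <= 1 / 2 -> expR x + expR (- x) <= 2 * expR (2 * x ^+ 2).
Proof.
move=> x1.
have H1 := expR_le_quad x1.
have H2 : expR (- x) <= 1 - x + 2 * x ^+ 2 by rewrite -[x ^+ 2]sqrrN expR_le_quad// normrN.
have := expR_ge1Dx (2 * x ^+ 2).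
lra.
Qed.

(** Independence of the signs: the sum over all sign choices factors into a product over [(i, u)],
    and each factor is bounded by [expRD_expRN_le], where the linear terms cancel. *)
Lemma sum_expR_signs (I : finType) (t : I -> U -> R) : (forall i u, `|t i u| <= 1 / 2) ->
  \sum_(s : {ffun I -> {ffun U -> bool}}) expR (\sum_i \sum_u sgb (s i u) * t i u) <=
  #|{ffun I -> {ffun U -> bool}}|%:R * expR (2 * \sum_i \sum_u t i u ^+ 2).
Proof.
move=> t1.
have -> : \sum_(s : {ffun I -> {ffun U -> bool}}) expR (\sum_i \sum_u sgb (s i u) * t i u) =
   \prod_i \prod_u (expR (t i u) + expR (- t i u)).
  rewrite (eq_bigr (fun s : {ffun I -> {ffun U -> bool}} =>
      \prod_i \prod_u expR (sgb (s i u) * t i u))); last first.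
    by move=> s _; rewrite expR_sum; apply: eq_bigr => i _; rewrite expR_sum.
  rewrite -(bigA_distr_bigA (fun i (tau : {ffun U -> bool}) =>
      \prod_u expR (sgb (tau u) * t i u))).
  apply: eq_bigr => i _.
  rewrite -(bigA_distr_bigA (fun u b => expR (sgb b * t i u))).
  apply: eq_bigr => u _.
  by rewrite sum_bool_fun /sgb expr1 expr0 mul1r mulN1r addrC.
have -> : #|{ffun I -> {ffun U -> bool}}|%:R * expR (2 * \sum_i \sum_u t i u ^+ 2) =
   \prod_i \prod_u (2 * expR (2 * t i u ^+ 2)).
  under eq_bigr do rewrite big_split /= prodr_const -expR_sum -mulr_sumr.
  rewrite big_split /= prodr_const -expR_sum -mulr_sumr; congr (_ * _).
  by rewrite !card_ffun card_bool !natrX.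
apply: ler_prod => i _; apply/andP; split.
  by apply: prodr_ge0 => u _; rewrite addr_ge0// expR_ge0.
apply: ler_prod => u _; apply/andP; split; first by rewrite addr_ge0// expR_ge0.
exact: expRD_expRN_le.
Qed.

End SignSums.
Arguments sgb {R}.

(** * Riesz products *)

Section Riesz.
Variables (R : realType) (A : finType) (p : seq A -> R).
Hypothesis p_ge0 : forall w, 0 <= p w.
Hypothesis p_nil : p [::] = 1.
Hypothesis p_rcons : forall w, \sum_a p (rcons w a) = p w.
Hypothesis p_cons : forall w, \sum_a p (a :: w) = p w.
Variable g : A -> R.
Hypothesis g2 : forall a, g a ^+ 2 = 1.

(* Junk value 0 when [size w <= m]. *)
Definition gat m (w : seq A) : R := nth 0 (map g w) m.
(** The martingale difference at position [m]. *)
Definition dvat m (w : seq A) : R := gat m w - cmean p g (take m w).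

Lemma gat_norm m w : `|gat m w| <= 1.
Proof.
rewrite /gat; case: (ltnP m (size w)) => [ltm|lem]; last first.
  by rewrite nth_default ?size_map// normr0.
case: w ltm => // a w ltm; rewrite (nth_map a)//.
by rewrite (norm_g g2).
Qed.

Lemma dvat_norm m w : `|dvat m w| <= 2.
Proof.
rewrite (le_trans (ler_normB _ _))//.
have := gat_norm m w; have := @cmean_norm _ _ _ p_ge0 p_rcons _ g2 (take m w).
by lra.
Qed.

Lemma gat_rcons_lt m w a : (m < size w)%N -> gat m (rcons w a) = gat m w.
Proof. by move=> ltm; rewrite /gat map_rcons nth_rcons size_map ltm. Qed.

Lemma gat_rcons_size w a : gat (size w) (rcons w a) = g a.
Proof. by rewrite /gat map_rcons nth_rcons size_map ltnn eqxx. Qed.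

Lemma take_rcons_le m w (a : A) : (m <= size w)%N -> take m (rcons w a) = take m w.
Proof. by move=> lem; rewrite -cats1 takel_cat. Qed.

Lemma dvat_rcons_lt m w a : (m < size w)%N -> dvat m (rcons w a) = dvat m w.
Proof. by move=> ltm; rewrite /dvat gat_rcons_lt// take_rcons_le// ltnW. Qed.

Lemma dvat_rcons_size w a : dvat (size w) (rcons w a) = g a - cmean p g w.
Proof. by rewrite /dvat gat_rcons_size take_rcons_le// take_size. Qed.

Section Product.
Variables (L : nat) (sg : nat -> seq A -> R).
Hypothesis sg1 : forall j w, `|sg j w| <= 1.

(** The sign is read off [W'] at positions [j] to [j + L - 1], all before the position [j + L] of
    the deviations. Dividing by 4 keeps the factor nonnegative, as deviations are at most 2 in
    absolute value. *)
Definition riesz_factor j (W W' : seq A) : R :=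
  1 + sg j (take L (drop j W')) * (dvat (j + L) W * dvat (j + L) W' / 4).

Definition riesz n (W W' : seq A) : R := \prod_(j < n) riesz_factor j W W'.

Lemma riesz_ge0 n W W' : 0 <= riesz n W W'.
Proof.
apply: prodr_ge0 => j _; rewrite /riesz_factor.
set s := sg _ _; set x := dvat _ W; set y := dvat _ W'.
suff : `|s * (x * y / 4)| <= 1 by move=> /ler_normlP[]; lra.
rewrite 3!normrM -[leRHS]mulr1 ler_pM//; first exact: sg1.
have xy : `|x| * `|y| <= 2 * 2 by rewrite ler_pM// dvat_norm.
rewrite normfV normr_nat.
by rewrite ler_pdivrMr// mul1r (le_trans xy)//; lra.
Qed.

Lemma take_drop_rcons j w (a : A) : (j + L <= size w)%N ->
  take L (drop j (rcons w a)) = take L (drop j w).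
Proof.
move=> le_jL; rewrite drop_rcons; last by rewrite (leq_trans _ le_jL)// leq_addr.
by rewrite take_rcons_le// size_drop leq_subRL// (leq_trans _ le_jL)// leq_addr.
Qed.

Lemma riesz_rcons_r n W W' a : (n + L <= size W')%N ->
  riesz n W (rcons W' a) = riesz n W W'.
Proof.
move=> sW'; apply: eq_bigr => j _; rewrite /riesz_factor.
have ltj : (j + L < n + L)%N by rewrite ltn_add2r.
by rewrite take_drop_rcons ?dvat_rcons_lt// ?(leq_trans ltj)// (leq_trans (ltnW ltj)).
Qed.

Lemma riesz_rcons_l n W W' a : (n + L <= size W)%N ->
  riesz n (rcons W a) W' = riesz n W W'.
Proof.
move=> sW; apply: eq_bigr => j _; rewrite /riesz_factor.
have ltj : (j + L < n + L)%N by rewrite ltn_add2r.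
by rewrite dvat_rcons_lt// (leq_trans ltj).
Qed.

(** Sum out the last letter of [W']: the earlier factors and the last sign do not depend on it, and
    the part linear in the last deviation vanishes by [dev_centered]. *)
Lemma riesz_marginal_r n W : wsum (n + L) (fun W' => riesz n W W' * p W') = 1.
Proof.
elim: n => [|n IH].
  by under eq_wsum do rewrite /riesz big_ord0 mul1r; exact: wsum_p.
rewrite addSn wsumS_rcons -[RHS]IH; apply: eq_wsum => W' sW'.
have sW := eq_leq (esym sW').
under eq_bigr => a _.
  rewrite {1}/riesz big_ord_recr /= -/(riesz n W (rcons W' a)) riesz_rcons_r//.
  rewrite /riesz_factor take_drop_rcons// -{2}sW' dvat_rcons_size.
  rewrite (_ : _ * p _ = riesz n W W' * p (rcons W' a) +
    (riesz n W W' * sg n (take L (drop n W')) * dvat (n + L) W / 4) *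
    (p (rcons W' a) * (g a - cmean p g W'))); last by ring.
  over.
by rewrite big_split /= -!mulr_sumr p_rcons (dev_centered p_ge0 p_rcons g2) mulr0 addr0.
Qed.

(** The same argument on the other side, where the sign is constant because it reads only [W']. *)
Lemma riesz_marginal_l n W' : wsum (n + L) (fun W => riesz n W W' * p W) = 1.
Proof.
elim: n => [|n IH].
  by under eq_wsum do rewrite /riesz big_ord0 mul1r; exact: wsum_p.
rewrite addSn wsumS_rcons -[RHS]IH; apply: eq_wsum => W sW'.
have sW := eq_leq (esym sW').
under eq_bigr => a _.
  rewrite {1}/riesz big_ord_recr /= -/(riesz n (rcons W a) W') riesz_rcons_l//.
  rewrite /riesz_factor -{1}sW' dvat_rcons_size.
  rewrite (_ : _ * p _ = riesz n W W' * p (rcons W a) +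
    (riesz n W W' * sg n (take L (drop n W')) * dvat (n + L) W' / 4) *
    (p (rcons W a) * (g a - cmean p g W))); last by ring.
  over.
by rewrite big_split /= -!mulr_sumr p_rcons (dev_centered p_ge0 p_rcons g2) mulr0 addr0.
Qed.

End Product.

(** Letters after position [m] sum out by consistency; at position [m] itself [dev_corr] gives the
    conditional variance. *)
Lemma wsum_gat_dvat m N : (m < N)%N ->
  wsum N (fun W => p W * (gat m W * dvat m W)) = cvar p g m.
Proof.
elim: N => // N IH; rewrite ltnS leq_eqVlt => /orP[/eqP mN|ltmN].
  subst N; rewrite wsumS_rcons; apply: eq_wsum => w sw.
  rewrite -(dev_corr p_ge0 p_rcons g2); apply: eq_bigr => a _.
  by rewrite -sw gat_rcons_size dvat_rcons_size.
rewrite wsumS_rcons -IH//; apply: eq_wsum => w sw.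
under eq_bigr do rewrite gat_rcons_lt ?sw// dvat_rcons_lt ?sw//.
by rewrite -mulr_suml p_rcons.
Qed.

Section Average.
Variables (n L : nat).
Implicit Types s : {ffun 'I_n -> {ffun L.-tuple A -> bool}}.

(* Junk value 0 off [j < n] and [size w = L]. *)
Definition sgf s (j : nat) (w : seq A) : R :=
  if insub j is Some i then if insub w is Some t then sgb (s i t) else 0 else 0.

Lemma sgf_norm s j w : `|sgf s j w| <= 1.
Proof.
rewrite /sgf; case: insub => [i|]; last by rewrite normr0.
by case: insub => [t|]; rewrite ?normr0// norm_sgb.
Qed.

Lemma sgfE s (i : 'I_n) (t : L.-tuple A) : sgf s i t = sgb (s i t).
Proof. by rewrite /sgf !valK. Qed.

(** Orthogonality of independent signs: multiplying by the sign at time [j] and averaging leaves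
    only the term of the expanded product that is linear in that sign and contains no other. *)
Lemma avg_riesz (j : 'I_n) W W' : size W' = (n + L)%N ->
  \sum_s riesz L (sgf s) n W W' * sgf s j (take L (drop j W')) =
  #|{ffun 'I_n -> {ffun L.-tuple A -> bool}}|%:R *
    (dvat (j + L) W * dvat (j + L) W' / 4).
Proof.
move=> sW'.
have st (i : 'I_n) : size (take L (drop i W')) == L.
  rewrite size_takel// size_drop sW'; have := ltn_ord i; lia.
pose t i : L.-tuple A := Tuple (st i).
pose x i := dvat (i + L) W * dvat (i + L) W' / 4.
(* The test sign is absorbed into the factor with index [j], so that the summand is a product over
   times and the sum over [s] factors. *)
pose phi (i : 'I_n) (tau : {ffun L.-tuple A -> bool}) : R :=
  (1 + sgb (tau (t i)) * x i) * (if i == j then sgb (tau (t i)) else 1).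
rewrite (eq_bigr (fun s => \prod_i phi i (s i))); last first.
  move=> s _; rewrite /phi big_split /= -big_mkcond big_pred1_eq.
  rewrite -[take L (drop j W')]/(val (t j)) sgfE; congr (_ * _).
  by apply: eq_bigr => i _; rewrite /riesz_factor -[take L _]/(val (t i)) sgfE.
rewrite -bigA_distr_bigA.
have sphi i : \sum_tau phi i tau =
    #|{ffun L.-tuple A -> bool}|%:R * (if i == j then x i else 1).
  rewrite /phi; case: eqP => _.
    under eq_bigr do rewrite mulrDl mul1r mulrAC sgb_sqr mul1r.
    by rewrite big_split /= sum_sgb sumr_const add0r mulr_natl.
  under eq_bigr do rewrite mulr1.
  by rewrite big_split /= -mulr_suml sum_sgb sumr_const mul0r addr0 mulr1.
under eq_bigr do rewrite sphi.
rewrite big_split /= prodr_const -big_mkcond big_pred1_eq; congr (_ * _).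
by rewrite [in RHS]card_ffun natrX.
Qed.

(** The integral of sign times [g(x_(j+L)) g(y_(j+L))] against the [s]-coupling, the sign being the
    one that [s] itself assigns to the word of [y] at time [j]. *)
Definition riesz_corr s (j : nat) : R :=
  wsum (n + L) (fun W => wsum (n + L) (fun W' =>
    riesz L (sgf s) n W W' * sgf s j (take L (drop j W')) *
    (p W * p W' * (gat (j + L) W * gat (j + L) W')))).

Lemma avg_riesz_corr (j : 'I_n) : \sum_s riesz_corr s j =
  #|{ffun 'I_n -> {ffun L.-tuple A -> bool}}|%:R * (cvar p g (j + L) ^+ 2 / 4).
Proof.
rewrite wsum_exchange.
rewrite (eq_wsum (G := fun W => (#|{ffun 'I_n -> {ffun L.-tuple A -> bool}}|%:R *
   (cvar p g (j + L) / 4)) * (p W * (gat (j + L) W * dvat (j + L) W)))); last first.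
  move=> W sW; rewrite wsum_exchange.
  rewrite (eq_wsum (G := fun W' => (#|{ffun 'I_n -> {ffun L.-tuple A -> bool}}|%:R *
    (p W * (gat (j + L) W * dvat (j + L) W)) / 4) *
    (p W' * (gat (j + L) W' * dvat (j + L) W')))); last first.
    by move=> W' sW'; rewrite -mulr_suml avg_riesz//; ring.
  by rewrite wsumZ wsum_gat_dvat ?ltn_add2r//; ring.
by rewrite wsumZ wsum_gat_dvat ?ltn_add2r//; ring.
Qed.

End Average.
End Riesz.

(** * Cover numbers *)

Section Fekete.
Variables (R : realType) (a : nat -> R).
Hypothesis a_ge0 : forall n, 0 <= a n.
Hypothesis a_sub : forall n m, a (n + m)%N <= a n + a m.

Lemma subadd_mul q m : a (q * m)%N <= q%:R * a m + a 0%N.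
Proof.
elim: q => [|q IH]; first by rewrite mul0n mul0r add0r.
by rewrite mulSn (le_trans (a_sub _ _))// -natr1; lra.
Qed.

(** Fekete's lemma; the limit is the infimum of the quotients. Divide [n.+1] by a fixed block length
    [m.+1] whose quotient is nearly the infimum. *)
Lemma fekete : cvgn (fun n => a n.+1 / n.+1%:R).
Proof.
pose u n := a n.+1 / n.+1%:R.
have u_ge0 n : 0 <= u n by rewrite divr_ge0.
have hi : has_inf (range u).
  by split; [exists (u 0%N), 0%N | exists 0 => _ [n _ <-]].
pose l := inf (range u).
have l_le n : l <= u n by apply: ge_inf; [case: hi | exists n].
apply/cvg_ex; exists l; apply/cvgrPdist_le => e e0.
have e20 : 0 < e / 2 by rewrite divr_gt0.
have [_ [m _ <-] um] := inf_adherent e20 hi.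
rewrite -/l in um.
(* [C] bounds the error of the division: [a 0] from the [q] full blocks, and [m.+1 * a 1 + a 0] from
   the remainder. *)
pose C := m.+1%:R * a 1%N + 2 * a 0%N.
have C0 : 0 <= C by rewrite addr_ge0// mulr_ge0.
have [N HN] : exists N : nat, C <= N%:R * (e / 2).
  exists (Num.truncn (C / (e / 2))).+1.
  by rewrite -ler_pdivrMr// ltW// truncnS_gt.
exists N => // n /= leNn.
rewrite distrC ger0_norm ?subr_ge0//; [| exact: l_le].
rewrite lerBlDl -/(u n).
suff : u n <= u m + e / 2 by lra.
rewrite {1}/u ler_pdivrMr// mulrDl.
have -> : n.+1 = (n.+1 %/ m.+1 * m.+1 + n.+1 %% m.+1)%N by rewrite -divn_eq.
set q := (n.+1 %/ m.+1)%N; set r := (n.+1 %% m.+1)%N.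
have rm : (r <= m.+1)%N by rewrite ltnW// ltn_mod.
have H1 := subadd_mul q m.+1.
have H2 : a r <= m.+1%:R * a 1%N + a 0%N.
  rewrite -[r]muln1 (le_trans (subadd_mul r 1))// lerD2r ler_wpM2r// ler_nat//.
have H3 : q%:R * a m.+1 <= u m * (q * m.+1 + r)%:R.
  rewrite natrD natrM mulrDr /u.
  rewrite [X in _ <= X + _](_ : _ = q%:R * a m.+1); last by rewrite mulrCA divfK.
  by rewrite lerDl mulr_ge0// u_ge0.
have H4 : C <= e / 2 * (q * m.+1 + r)%:R.
  rewrite (le_trans HN)// mulrC ler_wpM2l ?(ltW e20)// ler_nat -divn_eq.
  exact: leq_trans leNn _.
have := a_sub (q * m.+1) r; rewrite /C in H4; lra.
Qed.

End Fekete.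

Section CoverNumber.
Variables (R : realType) (P : Type) (S : set P) (phi : P -> P).
Variables (k : nat) (U : 'I_k -> set P).
Hypothesis phiS : forall x, S x -> S (phi x).
Hypothesis U_cover : forall x, S x -> exists i, U i x.

Definition join_covering n (A : {set {ffun 'I_n -> 'I_k}}) : Prop :=
  forall x, S x -> exists2 w, w \in A & join_cell phi U w x.

Lemma iter_stable n x : S x -> S (iter n phi x).
Proof. by move=> Sx; elim: n => //= n; exact: phiS. Qed.

Lemma join_coveringT n : @join_covering n (finset.setTfor {ffun 'I_n -> 'I_k}).
Proof.
move=> x Sx.
have /choice [w Hw] : forall j : 'I_n, exists i, U i (iter j phi x).
  by move=> j; apply: U_cover; exact: iter_stable.
by exists (finfun w); rewrite ?inE// => j; rewrite ffunE.
Qed.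

Lemma cover_number_le n A : @join_covering n A -> (cover_number S phi U n <= #|A|)%N.
Proof.
move=> cA; rewrite /cover_number.
have : A \in index_enum {set {ffun 'I_n -> 'I_k}} by rewrite mem_index_enum.
elim: (index_enum _) => // B s IH; rewrite inE => /orP[/eqP <-|/IH {}IH].
  by rewrite big_cons; case: asboolP => // _; rewrite geq_minl.
by rewrite big_cons; case: asboolP => // _; rewrite geq_min IH orbT.
Qed.

(** The initial value of the minimum, the number of all words, is itself attained by the full
    family, which covers. *)
Lemma cover_number_attained n :
  exists2 A, @join_covering n A & #|A| = cover_number S phi U n.
Proof.
rewrite /cover_number; apply: (big_ind (fun m => exists2 A, @join_covering n A & #|A| = m)).
- by exists (finset.setTfor {ffun 'I_n -> 'I_k}); [exact: join_coveringT | rewrite cardsT].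
- move=> x y Hx Hy; rewrite /minn; case: ifP => //.
- by move=> A /asboolP cA; exists A.
Qed.

Lemma cover_number_gt0 n : S !=set0 -> (0 < cover_number S phi U n)%N.
Proof.
move=> [x Sx]; have [A cA <-] := cover_number_attained n.
by have [w wA _] := cA x Sx; apply/card_gt0P; exists w.
Qed.

Definition ffun_cat n m (w : {ffun 'I_n -> 'I_k}) (w' : {ffun 'I_m -> 'I_k}) :
    {ffun 'I_(n + m) -> 'I_k} :=
  [ffun j => match fintype.split j with inl i => w i | inr i => w' i end].

(** Concatenating the words of two optimal families, the second used at the point shifted by [n]
    steps, gives a covering family for time [n + m]. *)
Lemma cover_numberD n m : (cover_number S phi U (n + m) <=
  cover_number S phi U n * cover_number S phi U m)%N.
Proof.
have [A cA <-] := cover_number_attained n.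
have [B cB <-] := cover_number_attained m.
rewrite -cardsX.
apply: (@leq_trans #|(fun z => ffun_cat z.1 z.2) @: finset.setX A B|);
  last exact: leq_imset_card.
apply: cover_number_le => x Sx.
have [w wA xw] := cA x Sx.
have [w' wB xw'] := cB _ (iter_stable n Sx).
exists (ffun_cat w w').
  by apply/imsetP; exists (w, w') => //; rewrite finset.in_setX wA.
move=> j; rewrite ffunE; case: split_ordP => i ->; first exact: xw.
by rewrite /= addnC iterD; exact: xw'.
Qed.

(** A bound on each term passes to [limn] only if the sequence converges, which Fekete's lemma gives
    for the logarithms of the cover numbers. *)
Lemma cover_entropy_ge (th : R) : S !=set0 ->
  (forall n A, @join_covering n.+1 A -> expR (th * n.+1%:R) <= #|A|%:R) ->
  th <= cover_entropy R S phi U.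
Proof.
move=> S0 thA.
have N0 n : 0 < (cover_number S phi U n)%:R :> R by rewrite ltr0n cover_number_gt0.
apply: limr_ge.
  apply: (@fekete _ (fun n => ln (cover_number S phi U n)%:R)) => [n|n m].
    by rewrite ln_ge0// ler1n cover_number_gt0.
  rewrite -lnM ?posrE// -natrM ler_ln ?posrE// ?ler_nat ?cover_numberD//.
  by rewrite natrM mulr_gt0.
apply: nearW => n; rewrite ler_pdivlMr//.
have [A cA cN] := cover_number_attained n.+1.
by rewrite -[leLHS]expRK ler_ln ?posrE ?expR_gt0// -cN thA.
Qed.

End CoverNumber.

(** * Names and couplings with a density *)

Section FiniteMeasures.
Variables (R : realType) (d : measure_display) (Y : measurableType d).

Lemma measure_fiber (I : finType) (m : {measure set Y -> \bar R}) (h : Y -> I) B :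
  (forall i, measurable [set y | h y = i]) -> measurable B ->
  m B = (\sum_i m (B `&` [set y | h y = i]))%E.
Proof.
move=> mh mB.
have BE : B = \bigcup_(i in [set: I]) (B `&` [set y | h y = i]).
  apply/seteqP; split=> [y By|y [i _ []]//].
  by exists (h y).
rewrite {1}BE measure_fin_bigcup//.
- rewrite (fsbigE (index_enum I)) ?index_enum_uniq//; last first.
    by move=> i _; rewrite mem_index_enum.
  by apply: eq_bigl => i; rewrite in_setT.
- exact: finite_finset.
- by apply/trivIsetP => i j _ _ ij; apply/seteqP; split=> y //= [[_ hi] [_ hj]];
    move: ij; rewrite -hi -hj eqxx.
- by move=> i _; exact: measurableI.
Qed.

Lemma fin_sum_measure (I : Type) (s : seq I) (c : I -> R)
    (m_ : I -> {measure set Y -> \bar R}) : (forall i, 0 <= c i) ->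
  exists m : {measure set Y -> \bar R},
    forall E, m E = (\sum_(i <- s) (c i)%:E * m_ i E)%E.
Proof.
move=> c0; elim: s => [|i s [m mE]].
  by exists mzero => E; rewrite big_nil.
exists (measure_add (mscale (NngNum (c0 i)) (m_ i)) m) => E.
by rewrite big_cons -mE; exact: measure_addE.
Qed.

(** Normalising a measure of mass one leaves its values unchanged and supplies the [probability]
    structure. *)
Lemma measure_probability (m : {measure set Y -> \bar R}) : m setT = 1%E ->
  exists P : probability Y R, forall E, P E = m E.
Proof.
move=> m1; exists (mnormalize m (\d_(point : Y))) => E.
by rewrite /= /mnormalize m1 onee_eq0/= invr1 mule1.
Qed.

End FiniteMeasures.

Section Names.
Variables (R : realType) (d : measure_display) (X : measurableType d).
Variables (mu : probability X R) (T : X -> X).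
Hypothesis mT : measurable_fun setT T.
Hypothesis muT : forall A, measurable A -> mu (T @^-1` A) = mu A.
Variables (C : finType) (c : X -> C).
Hypothesis mc : forall i, measurable [set x | c x = i].

Lemma measurable_iter_preimage j A : measurable A -> measurable (iter j T @^-1` A).
Proof.
elim: j A => // j IH A mA.
rewrite [X in measurable X](_ : _ = iter j T @^-1` (T @^-1` A))//.
by apply: IH; rewrite -[_ @^-1` _]setTI; exact: mT.
Qed.

Lemma mu_iter j A : measurable A -> mu (iter j T @^-1` A) = mu A.
Proof.
elim: j A => // j IH A mA.
rewrite [X in mu X](_ : _ = iter j T @^-1` (T @^-1` A))// IH ?muT//.
by rewrite -[_ @^-1` _]setTI; exact: mT.
Qed.

Definition name n x := mkseq (fun i => c (iter i T x)) n.
Definition cyl (w : seq C) := [set x | name (size w) x = w].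
Definition letter m a := [set x | c (iter m T x) = a].
Definition wprob w : R := fine (mu (cyl w)).

Lemma size_name n x : size (name n x) = n. Proof. by rewrite size_mkseq. Qed.

Lemma nameS n x : name n.+1 x = rcons (name n x) (c (iter n T x)).
Proof. by rewrite /name mkseqS. Qed.

Lemma nameS_cons n x : name n.+1 x = c x :: name n (T x).
Proof.
rewrite /name /mkseq /=; congr (_ :: _).
rewrite -[1%N]addn0 iotaDl -map_comp; apply: eq_map => i /=.
exact: congr1 (iterSr _ _ _).
Qed.

Lemma take_drop_name n j m x : (j + m <= n)%N ->
  take m (drop j (name n x)) = name m (iter j T x).
Proof.
move=> le_n; apply: (@eq_from_nth _ (c x)).
  by rewrite size_name size_takel// size_drop size_name; lia.
rewrite size_takel ?size_drop ?size_name; last by lia.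
move=> i lti; rewrite nth_take// nth_drop !nth_mkseq//; last by lia.
by rewrite addnC iterD.
Qed.

Lemma measurable_letter m a : measurable (letter m a).
Proof. exact: measurable_iter_preimage (mc a). Qed.

Lemma cyl_nil : cyl [::] = setT. Proof. by apply/seteqP; split. Qed.

Lemma cyl_rcons w a : cyl (rcons w a) = cyl w `&` letter (size w) a.
Proof.
apply/seteqP; split=> x; rewrite /cyl /letter /= size_rcons nameS.
  by move=> /rcons_inj[-> ->].
by move=> [-> ->].
Qed.

Lemma measurable_cyl w : measurable (cyl w).
Proof.
elim/last_ind: w => [|w a IH]; first by rewrite cyl_nil.
by rewrite cyl_rcons; apply: measurableI => //; exact: measurable_letter.
Qed.

Lemma wprobE w : (wprob w)%:E = mu (cyl w).
Proof. by rewrite fineK// fin_num_measure//; exact: measurable_cyl. Qed.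

Lemma wprob_ge0 w : 0 <= wprob w. Proof. exact: fine_ge0. Qed.

Lemma wprob_nil : wprob [::] = 1.
Proof. by rewrite /wprob cyl_nil probability_setT. Qed.

Lemma wprob_rcons w : \sum_a wprob (rcons w a) = wprob w.
Proof.
apply: EFin_inj; rewrite -sumEFin wprobE.
rewrite (measure_fiber _ (fun a => measurable_letter (size w) a))//; last first.
  exact: measurable_cyl.
by apply: eq_bigr => a _; rewrite wprobE cyl_rcons.
Qed.

(** Stationarity: replace [cyl w] by its preimage under [T], of equal measure, and split by the
    letter at time 0. *)
Lemma wprob_cons w : \sum_a wprob (a :: w) = wprob w.
Proof.
apply: EFin_inj; rewrite -sumEFin wprobE -muT; last exact: measurable_cyl.
rewrite (measure_fiber _ mc); last first.
  by rewrite -[_ @^-1` _]setTI; apply: mT => //; exact: measurable_cyl.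
apply: eq_bigr => a _; rewrite wprobE; congr (mu _).
apply/seteqP; split=> x; rewrite /cyl /= nameS_cons.
  by move=> [-> ->].
by move=> [-> ->].
Qed.

Lemma measure_names N B : measurable B ->
  mu B = (\sum_(t : N.-tuple C) mu (B `&` cyl t))%E.
Proof.
move=> mB.
have nmE (x : X) (t : N.-tuple C) : (mktuple (fun i : 'I_N => c (iter i T x)) = t) <-> cyl t x.
  rewrite /cyl /= size_tuple; split=> [<-|H].
    by rewrite /name /mkseq -val_enum_ord -map_comp.
  by apply/val_inj; rewrite /= -H /name /mkseq -val_enum_ord -map_comp.
rewrite (@measure_fiber _ _ _ _ mu
  (fun x => mktuple (fun i : 'I_N => c (iter i T x))))//.
  apply: eq_bigr => t _; congr (mu (_ `&` _)).
  by apply/seteqP; split=> x /nmE.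
move=> t; rewrite [X in measurable X](_ : _ = cyl t); first exact: measurable_cyl.
by apply/seteqP; split=> x /nmE.
Qed.

Definition wmeas (B : set X) w : R := fine (mu (B `&` cyl w)).

Lemma wmeasE B w : measurable B -> (wmeas B w)%:E = mu (B `&` cyl w).
Proof.
by move=> mB; rewrite fineK// fin_num_measure//; apply: measurableI => //;
  exact: measurable_cyl.
Qed.

Lemma wmeas_sum N B : measurable B -> wsum N (wmeas B) = fine (mu B).
Proof.
move=> mB; apply: EFin_inj; rewrite fineK ?fin_num_measure// (measure_names N mB).
by rewrite /wsum -sumEFin; apply: eq_bigr => t _; rewrite wmeasE.
Qed.

Lemma wmeas_setT w : wmeas setT w = wprob w.
Proof. by rewrite /wmeas setTI. Qed.

(** The coupling has density [F (name x) (name y)] with respect to the product measure. As this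
    density is constant on products of cylinders, it is a finite weighted sum of restrictions, and
    the two sum conditions on [F] make both marginals [mu]. *)
Lemma density_coupling N (F : seq C -> seq C -> R) :
  (forall W W', 0 <= F W W') ->
  (forall W, wsum N (fun W' => F W W' * wprob W') = 1) ->
  (forall W', wsum N (fun W => F W W' * wprob W) = 1) ->
  exists2 rho, couplings mu rho &
    forall A B, measurable A -> measurable B ->
      fine (rho (A `*` B)) =
        wsum N (fun W => wsum N (fun W' => F W W' * (wmeas A W * wmeas B W'))).
Proof.
move=> F0 Fr Fl.
pose m_ (z : N.-tuple C * N.-tuple C) :=
  mrestr (mu \x mu)%E (measurableX (measurable_cyl z.1) (measurable_cyl z.2)).
have [m mE] := @fin_sum_measure R _ _ _ (index_enum (N.-tuple C * N.-tuple C)%type)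
  (fun z => F z.1 z.2) m_ (fun z => F0 _ _).
have mAB A B : measurable A -> measurable B -> m (A `*` B) =
   (wsum N (fun W => wsum N (fun W' => F W W' * (wmeas A W * wmeas B W'))))%:E.
  move=> mA mB; rewrite mE /wsum pair_bigA /= -sumEFin; apply: eq_bigr => -[W W'] _ /=.
  rewrite /m_ /mrestr /= -setXI product_measure1E; last 2 first.
  - by apply: measurableI => //; exact: measurable_cyl.
  - by apply: measurableI => //; exact: measurable_cyl.
  by rewrite !EFinM !wmeasE.
have mAT A : measurable A -> m (A `*` setT) = mu A.
  move=> mA; rewrite mAB// (eq_wsum (G := wmeas A)) ?wmeas_sum ?fineK ?fin_num_measure//.
  move=> W _; rewrite -[RHS]mulr1 -(Fr W) -wsumZ; apply: eq_wsum => W' _.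
  by rewrite wmeas_setT; ring.
have mTA A : measurable A -> m (setT `*` A) = mu A.
  move=> mA; rewrite mAB// /wsum exchange_big /= -/(wsum _ _).
  rewrite -[RHS]fineK ?fin_num_measure// -(wmeas_sum N mA) /wsum; congr (_%:E).
  apply: eq_bigr => W' _; rewrite -[RHS]mulr1 -(Fl W') -wsumZ; apply: eq_bigr => W _.
  by rewrite wmeas_setT; ring.
have m1 : m setT = 1%E by rewrite -setXTT mAT// probability_setT.
have [P PE] := measure_probability m1.
exists (P : set (X * X)%type -> \bar R).
  by exists P; split=> // A mA; rewrite !PE; split; [exact: mAT | exact: mTA].
by move=> A B mA mB; rewrite PE mAB.
Qed.

End Names.

(** * Correlations along the lens map *)

Section Lens.
Variables (R : realType) (d : measure_display) (X : measurableType d).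
Variables (mu : probability X R) (T : X -> X).
Hypothesis mT : measurable_fun setT T.
Hypothesis muT : forall A, measurable A -> mu (T @^-1` A) = mu A.

(** The image is the pushforward under [T] acting on both coordinates. *)
Lemma lens_map_coupling rho : couplings mu rho -> couplings mu (lens_map T rho).
Proof.
move=> [m [-> mE]].
have mh : measurable_fun setT (fun z : X * X => (T z.1, T z.2)).
  by apply: measurable_fun_pair; apply: measurableT_comp.
pose h : {mfun (X * X)%type >-> (X * X)%type} := mfun_Sub (mem_set mh).
exists (distribution m h); split => // A mA.
have mTA : measurable (T @^-1` A) by rewrite -[_ @^-1` _]setTI; exact: mT.
by have [H1 H2] := mE _ mTA; rewrite -(muT mA); split; [exact: H1 | exact: H2].
Qed.

Lemma iter_lens_mapE j (rho : set (X * X) -> \bar R) A B : iter j (lens_map T) rho (A `*` B) =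
  rho ((iter j T @^-1` A) `*` (iter j T @^-1` B)).
Proof. by elim: j A B => // j IH A B; exact: (IH (T @^-1` A) (T @^-1` B)). Qed.

Variables (C : finType) (c : X -> C).
Hypothesis mc : forall i, measurable [set x | c x = i].
Notation letter := (letter T c).
Notation cyl := (cyl T c).
Notation wprob := (wprob mu T c).
Notation wmeas := (wmeas mu T c).
Variable g : C -> R.
Hypothesis g2 : forall a, g a ^+ 2 = 1.

(** With [L = size w], this is the integral of [g(x_L) g(y_L)] over the pairs whose second name
    begins with [w]. It is a finite combination of rectangle measures, hence continuous on the
    lens. *)
Definition tcorr (rho : set (X * X) -> \bar R) w : R :=
  \sum_a \sum_b g a * g b * fine (rho (letter (size w) a `*` cyl (rcons w b))).

(** The rectangles in the sum partition the product of [X] with [cyl w], whose mass is given by the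
    second marginal. *)
Lemma tcorr_norm rho w : couplings mu rho -> `|tcorr rho w| <= wprob w.
Proof.
move=> [m [-> mE]].
have ml := measurable_letter mT mc; have mcyl := measurable_cyl mT mc.
have mX a b : measurable (letter (size w) a `*` cyl (rcons w b)).
  by apply: measurableX; [exact: ml | exact: mcyl].
apply: (@le_trans _ _ (\sum_a \sum_b fine (m (letter (size w) a `*` cyl (rcons w b))))).
  rewrite (le_trans (ler_norm_sum _ _ _))// ler_sum// => a _.
  rewrite (le_trans (ler_norm_sum _ _ _))// ler_sum// => b _.
  by rewrite !normrM !(norm_g g2) !mul1r ger0_norm// fine_ge0.
rewrite le_eqVlt; apply/orP; left; apply/eqP/EFin_inj.
rewrite pair_bigA /= -sumEFin (wprobE mu mT mc) -(mE _ (mcyl w)).2.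
have hE (a b : C) : [set z : X * X | (c (iter (size w) T z.1), c (iter (size w) T z.2)) = (a, b)] =
   letter (size w) a `*` letter (size w) b.
  by apply/seteqP; split => z /= => [[]|[-> ->]].
rewrite (@measure_fiber _ _ _ _ m (fun z => (c (iter (size w) T z.1), c (iter (size w) T z.2)))).
- apply: eq_bigr => -[a b] _ /=; rewrite fineK ?fin_num_measure//.
  by rewrite hE -setXI setTI cyl_rcons.
- by move=> [a b]; rewrite hE; apply: measurableX; exact: ml.
- by apply: measurableX => //; exact: mcyl.
Qed.

Lemma cyl_letter m W a0 x : (m < size W)%N -> cyl W x -> c (iter m T x) = nth a0 W m.
Proof. by move=> ltm <-; rewrite nth_mkseq. Qed.

Lemma sum_g_wmeas_letter m W : (m < size W)%N ->
  \sum_a g a * wmeas (letter m a) W = wprob W * gat g m W.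
Proof.
case: W => // a0 W ltm; set V := a0 :: W in ltm *.
rewrite /gat (nth_map a0)// (bigD1 (nth a0 V m))//= big1 ?addr0.
  rewrite mulrC /wmeas (_ : _ `&` _ = cyl V)//.
  by apply/seteqP; split => [x []//|x Vx]; split => //; exact: cyl_letter Vx.
move=> a am; rewrite /wmeas (_ : _ `&` _ = set0) ?measure0 ?mulr0//.
apply/seteqP; split => // x [xa Vx]; move: am; rewrite -xa.
by rewrite (cyl_letter a0 ltm Vx) eqxx.
Qed.

(** On [cyl W] all letters involved are fixed: the word seen at time [j] is either [w] or not, and
    only the true next letter contributes. *)
Lemma sum_g_wmeas_cyl j w W : (j + size w < size W)%N ->
  \sum_b g b * wmeas (iter j T @^-1` cyl (rcons w b)) W =
  wprob W * gat g (j + size w) W * (take (size w) (drop j W) == w)%:R.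
Proof.
move=> ltW; rewrite -sum_g_wmeas_letter// mulr_suml; apply: eq_bigr => b _.
rewrite -mulrA; congr (_ * _).
have nmE x : cyl W x -> name T c (size w) (iter j T x) = take (size w) (drop j W).
  by move=> {1}<-; rewrite take_drop_name// ltnW.
have it x : iter (size w) T (iter j T x) = iter (j + size w) T x by rewrite addnC iterD.
case: eqP => [wE|wE].
  rewrite mulr1 /wmeas; congr (fine (mu _)); rewrite cyl_rcons.
  apply/seteqP; split => x [].
    by move=> [] /= _ xb Wx; split => //; move: xb; rewrite /letter /= it.
  move=> xb Wx; split => //; split; first by rewrite /cyl /= nmE.
  by rewrite /letter /= it.
rewrite mulr0 /wmeas (_ : _ `&` _ = set0) ?measure0//.
apply/seteqP; split => // x []; rewrite cyl_rcons => -[/= xw _] Wx.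
by apply: wE; rewrite -(nmE x Wx).
Qed.

Section Density.
Variables (n L : nat) (s : {ffun 'I_n -> {ffun L.-tuple C -> bool}}).
Notation F := (riesz wprob g L (sgf R s) n).

(** Words of length [n + L] determine everything up to time [j + L]. Summing over [w] picks out the
    word that [y] shows at time [j], so the signs recombine into [riesz_corr]. *)
Lemma riesz_coupling : exists2 rho, couplings mu rho &
  forall j : 'I_n, \sum_(w : L.-tuple C) sgf R s j w * tcorr (iter j (lens_map T) rho) w =
     riesz_corr wprob g s j.
Proof.
have P0 := @wprob_ge0 _ _ _ mu T C c.
have Pn := @wprob_nil _ _ _ mu T C c.
have Pr := wprob_rcons mu mT mc.
have Pc := wprob_cons mT muT mc.
have [rho crho rhoE] := density_coupling mT mc
  (fun W W' => riesz_ge0 P0 Pr g2 L (sgf_norm R s) n W W')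
  (riesz_marginal_r P0 Pn Pr Pc g2 L (sgf R s) n)
  (riesz_marginal_l P0 Pn Pr Pc g2 L (sgf R s) n).
exists rho => // j.
have ltj : (j + L < n + L)%N by rewrite ltn_add2r.
have tE (w : L.-tuple C) : tcorr (iter j (lens_map T) rho) w =
   wsum (n + L) (fun W => wsum (n + L) (fun W' =>
     F W W' * (wprob W * wprob W' * (gat g (j + L) W * gat g (j + L) W')) *
      (take L (drop j W') == w)%:R)).
  rewrite /tcorr.
  under eq_bigr => a _.
    under eq_bigr => b _.
      rewrite iter_lens_mapE rhoE; last 2 first.
      - by apply: measurable_iter_preimage => //; exact: measurable_letter.
      - by apply: measurable_iter_preimage => //; exact: measurable_cyl.
      rewrite -wsumZ.
      under eq_wsum do rewrite -wsumZ.
      over.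
    rewrite wsum_exchange.
    under eq_wsum do rewrite wsum_exchange.
    over.
  rewrite wsum_exchange; apply: eq_wsum => W sW.
  rewrite wsum_exchange; apply: eq_wsum => W' sW'.
  have HW := @sum_g_wmeas_letter (j + L) W; rewrite sW in HW.
  have HW' := @sum_g_wmeas_cyl j w W'; rewrite sW' size_tuple in HW'.
  rewrite (_ : _ * _ * _ = F W W' * (wprob W * gat g (j + L) W) *
      (wprob W' * gat g (j + L) W' * (take L (drop j W') == w)%:R)); last by ring.
  rewrite -HW// -HW'// -mulrA mulr_suml mulr_sumr; apply: eq_bigr => a _.
  rewrite mulr_sumr mulr_sumr; apply: eq_bigr => b _.
  rewrite size_tuple (_ : iter j T @^-1` letter L a = letter (j + L) a); first by ring.
  by apply/seteqP; split => x; rewrite /letter /= addnC iterD.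
under eq_bigr do rewrite tE -wsumZ.
rewrite wsum_exchange; apply: eq_wsum => W sW.
under eq_bigr do rewrite -wsumZ.
rewrite wsum_exchange; apply: eq_wsum => W' sW'.
have st : size (take L (drop j W')) == L.
  by rewrite size_takel// size_drop sW'; have := ltn_ord j; lia.
rewrite (bigD1 (Tuple st))//= eqxx big1 ?addr0; first by rewrite mulr1; ring.
move=> w wn; rewrite (_ : _ == _ = false) ?mulr0//.
by apply/negP => /eqP wE; move: wn => /eqP; apply; apply/val_inj.
Qed.

End Density.
End Lens.

(** * Long cylinders have small measure *)

Section SmallAtoms.
Variables (R : realType) (d : measure_display) (X : measurableType d).
Variables (mu : probability X R) (T : X -> X).
Hypothesis mT : measurable_fun setT T.
Hypothesis muT : forall A, measurable A -> mu (T @^-1` A) = mu A.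
Hypothesis ergT : ergodic mu T.
Variables (C : finType) (c : X -> C).
Hypothesis mc : forall i, measurable [set x | c x = i].
Notation cyl := (cyl T c).
Notation wprob := (wprob mu T c).

(** Pigeonhole: [N] disjoint preimages of [B] would have total measure above 1. *)
Lemma recurrence (B : set X) (N : nat) : measurable B -> (1 < N%:R%:E * mu B)%E ->
  exists i j x, [/\ (i < j < N)%N, B (iter i T x) & B (iter j T x)].
Proof.
move=> mB NB; apply: contrapT => nex.
pose F (i : 'I_N) := iter i T @^-1` B.
have mF i : measurable (F i) by exact: measurable_iter_preimage.
have tF : trivIset setT F.
  apply/trivIsetP => i j _ _ ij; apply/seteqP; split => // x [Fi Fj]; apply: nex.
  have := ij; rewrite -(inj_eq val_inj) neq_ltn => /orP[lt|lt].
    by exists i, j, x; rewrite lt ltn_ord.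
  by exists j, i, x; rewrite lt ltn_ord.
have H : mu (\big[setU/set0]_(i < N) F i) = (\sum_(i < N) mu (F i))%E.
  exact: measure_bigsetU_ord.
have : (mu (\big[setU/set0]_(i < N) F i) <= 1)%E.
  by apply: probability_le1; exact: bigsetU_measurable.
rewrite {}H (eq_bigr (fun=> mu B)); last by move=> i _; exact: mu_iter.
move: NB; rewrite -(@fineK _ (mu B)) ?fin_num_measure// sumEFin sumr_const card_ord.
rewrite -EFinM -[fine _ *+ N]mulr_natl !ltNge => /negP nH H; exact: nH.
Qed.

(** Periodicity concerns the name, not the point itself. *)
Definition periodic r := [set x | forall l, c (iter (l + r) T x) = c (iter l T x)].

Definition periodic_upto r L :=
  [set x | forall l, (l < L)%N -> c (iter (l + r) T x) = c (iter l T x)].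

Lemma periodic_uptoS r L : periodic_upto r L.+1 =
  periodic_upto r L `&` [set x | c (iter (L + r) T x) = c (iter L T x)].
Proof.
apply/seteqP; split => [x H|x [H1 H2] l].
  by split; [move=> l lL; apply: H; rewrite ltnS ltnW | exact: H].
by rewrite ltnS leq_eqVlt => /orP[/eqP ->|/H1].
Qed.

Lemma measurable_periodic_upto r L : measurable (periodic_upto r L).
Proof.
elim: L => [|L IH].
  by rewrite [X in measurable X](_ : _ = setT)//; apply/seteqP; split.
rewrite periodic_uptoS; apply: measurableI => //.
rewrite [X in measurable X](_ : _ = \bigcup_(a in [set: C])
   (letter T c (L + r) a `&` letter T c L a)).
  apply: fin_bigcup_measurable; first exact: finite_finset.
  by move=> a _; apply: measurableI; exact: measurable_letter.
apply/seteqP; split => x /=; first by exists (c (iter L T x)).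
by move=> [a _ [H1 H2]]; rewrite H1 H2.
Qed.

Lemma periodicE r : periodic r = \bigcap_L periodic_upto r L.
Proof.
apply/seteqP; split => [x H L _ l _|x H l]; first exact: H.
exact: (H l.+1).
Qed.

Lemma measurable_periodic r : measurable (periodic r).
Proof.
by rewrite periodicE; apply: bigcapT_measurable => L; exact: measurable_periodic_upto.
Qed.

Lemma mu_periodic_ge r (e : R) : (forall L, e%:E <= mu (periodic_upto r L))%E ->
  (e%:E <= mu (periodic r))%E.
Proof.
move=> H; rewrite periodicE.
have cv : mu \o periodic_upto r @ \oo --> mu (\bigcap_L periodic_upto r L).
  apply: nonincreasing_cvg_mu.
  - by rewrite (le_lt_trans (probability_le1 _ _)) ?ltry//; exact: measurable_periodic_upto.
  - by move=> L; exact: measurable_periodic_upto.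
  - by apply: bigcapT_measurable => L; exact: measurable_periodic_upto.
  - move=> L L' LL'; apply/subsetPset => x H' l lL; apply: H'.
    exact: leq_trans LL'.
by apply: (cvge_ge _ cv); apply: nearW => L; exact: H.
Qed.

(** The set is only forward invariant. The increasing union of its preimages is strictly invariant
    and has the same measure, so ergodicity applies to that union. *)
Lemma mu_periodic_zero_one r : (0 < mu (periodic r))%E -> mu (periodic r) = 1%E.
Proof.
move=> mu0.
pose F n := iter n T @^-1` periodic r.
have mF n : measurable (F n) by apply: measurable_iter_preimage => //; exact: measurable_periodic.
have PT x : periodic r x -> periodic r (T x).
  by move=> H l; rewrite -!iterSr -addSn; exact: H.
have FS n : F n `<=` F n.+1 by move=> x; exact: PT.
have F_nd : nondecreasing_seq F.
  move=> n m /subnK <-; apply/subsetPset; elim: (m - n)%N => // l IH.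
  by rewrite addSn; apply: (subset_trans IH); exact: FS.
have mU : measurable (\bigcup_n F n) by exact: bigcupT_measurable.
have muU : mu (\bigcup_n F n) = mu (periodic r).
  have H := nondecreasing_cvg_mu mF mU F_nd (mu := mu).
  have E : mu \o F = cst (mu (periodic r)).
    by apply/funext => n /=; rewrite /F (mu_iter mT muT)//; exact: measurable_periodic.
  rewrite E in H.
  by rewrite -(cvg_lim (@ereal_hausdorff R) H) lim_cst.
have UT : T @^-1` (\bigcup_n F n) = \bigcup_n F n.
  apply/seteqP; split => x [n _ Fn].
    by exists n.+1 => //; rewrite /F /= -iterS iterSr.
  exists n => //; have := FS n x Fn.
  by rewrite /F /= -iterS iterSr.
by have := ergT mU UT; rewrite muU => -[H|//]; rewrite H ltxx in mu0.
Qed.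

Lemma cyl_sub_periodic N w : (1 < N%:R%:E * mu (cyl w))%E ->
  cyl w `<=` periodic_upto N`! (size w - N`!).
Proof.
move=> /(recurrence (measurable_cyl mT mc w)) [i [j [x [/andP[ij jN] xi xj]]]].
case: w xi xj => [|a0 w'] xi xj; first by move=> y _ l; rewrite /= sub0n.
set w := a0 :: w' in xi xj *.
have wi l : (l < size w)%N -> nth a0 w l = c (iter (l + i) T x).
  by move=> lw; rewrite iterD (cyl_letter a0 lw xi).
have wj l : (l < size w)%N -> nth a0 w l = c (iter (l + j) T x).
  by move=> lw; rewrite iterD (cyl_letter a0 lw xj).
have per q l : (l + q * (j - i) < size w)%N -> nth a0 w (l + q * (j - i)) = nth a0 w l.
  elim: q => [|q IH]; first by rewrite mul0n addn0.
  move=> lt; rewrite wi// (_ : l + q.+1 * (j - i) + i = l + q * (j - i) + j)%N; last first.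
    by rewrite mulSn; lia.
  by rewrite -wj ?IH//; apply: leq_ltn_trans lt; rewrite mulSn; lia.
have /dvdnP[q qE] : (j - i %| N`!)%N by apply: dvdn_fact; lia.
move=> y wy l lt.
have lt1 : (l + N`! < size w)%N by lia.
have lt2 : (l < size w)%N by lia.
rewrite (cyl_letter a0 lt1 wy) (cyl_letter a0 lt2 wy).
by rewrite qE per// -qE.
Qed.

(** Almost surely the letter at time [r] repeats the letter at time 0, so the first [r] letters
    determine it and no conditional variance is left. *)
Lemma cvar_periodic r (g : C -> R) : (forall a, g a ^+ 2 = 1) -> (0 < r)%N ->
  mu (periodic r) = 1%E -> cvar wprob g r = 0.
Proof.
move=> g2 r0 mu1; rewrite /cvar /wsum big1// => t _.
have : size t = r by rewrite size_tuple.
case: (tval t) => [|a0 w' sw]; first by move=> r00; rewrite -r00 in r0.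
set w := a0 :: w' in sw *.
have mu0 : mu (~` periodic r) = 0%E.
  by rewrite probability_setC ?mu1 ?subee//; exact: measurable_periodic.
have p0 a : a != a0 -> wprob (rcons w a) = 0.
  move=> aa0; rewrite /wprob (_ : mu _ = 0%E)//.
  apply: (@subset_measure0 _ _ _ mu _ (~` periodic r)).
  - exact: measurable_cyl.
  - by apply: measurableC; exact: measurable_periodic.
  - move=> x; rewrite cyl_rcons => -[xw xa] /(_ 0%N).
    rewrite add0n -sw xa (cyl_letter a0 _ xw)//= => aE.
    by rewrite aE eqxx in aa0.
  - exact: mu0.
have Pr := wprob_rcons mu mT mc.
have pw : wprob (rcons w a0) = wprob w.
  by rewrite -(Pr w) (bigD1 a0)//= big1 ?addr0// => a; exact: p0.
have cs : csum wprob g w = g a0 * wprob w.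
  by rewrite /csum (bigD1 a0)//= big1 ?addr0 ?pw// => a /p0 ->; rewrite mulr0.
rewrite /cmean cs; have [->|pn0] := eqVneq (wprob w) 0; first by rewrite mul0r.
by rewrite mulfK// g2 subrr mulr0.
Qed.

(** If cylinders of measure above [e] existed at every length, names of period [N]![would have
    positive measure, hence full measure, and the conditional variance given]N[!] letters would
    vanish. *)
Lemma small_atoms (g : C -> R) (v : R) : (forall a, g a ^+ 2 = 1) -> 0 < v ->
  (forall n, v <= cvar wprob g n) ->
  forall e, 0 < e -> exists L, forall w, size w = L -> wprob w <= e.
Proof.
move=> g2 v0 gv e e0; apply: contrapT => /forallNP big.
have [N N0 Ne] : exists2 N, (0 < N)%N & 1 < N%:R * e.
  exists (Num.truncn e^-1).+1 => //.
  have ie : 0 <= e^-1 by rewrite invr_ge0 ltW.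
  by have /andP[_ lt] := truncn_itv ie; rewrite -ltr_pdivrMr// mul1r.
have r0 : (0 < N`!)%N by exact: fact_gt0.
have muP : (e%:E <= mu (periodic N`!))%E.
  apply: mu_periodic_ge => L.
  have /existsNP[w /not_implyP[sw /negP]] := big (L + N`!)%N.
  rewrite -ltNge => ew.
  have mw : (e%:E <= mu (cyl w))%E by rewrite -(wprobE mu mT mc) lee_fin ltW.
  apply: (le_trans mw); apply: le_measure; rewrite ?inE.
  - exact: measurable_cyl.
  - exact: measurable_periodic_upto.
  - rewrite -[L](addnK N`!) -sw; apply: cyl_sub_periodic.
    rewrite -(wprobE mu mT mc) -EFinM lte_fin (lt_le_trans Ne)// ler_wpM2l// ltW//.
have mu1 : mu (periodic N`!) = 1%E.
  by apply: mu_periodic_zero_one; rewrite (lt_le_trans _ muP)// lte_fin.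
have := gv N`!; rewrite cvar_periodic// leNgt v0//.
Qed.

End SmallAtoms.

(** * Counting cells *)

Section FineCover.
Variables (R : realType) (I P : Type).
Variables (J : set I) (f : I -> P -> R) (S : set P).
Variables (K : finType) (h : K -> I).
Hypothesis hJ : forall j, J (h j).
Hypothesis f01 : forall j x, S x -> 0 <= f (h j) x <= 1.

(** The cells are open boxes of radius [e] around the grid points [r * e] of the cube, in finitely
    many coordinates. *)
Lemma fine_cover (e : R) : 0 < e -> exists k (U : 'I_k -> set P), open_cover J f S U /\
  forall i x y, U i x -> U i y -> forall j, `|f (h j) x - f (h j) y| <= 2 * e.
Proof.
move=> e0; pose q := Num.truncn e^-1.
pose V (r : {ffun K -> 'I_q.+1}) :=
  [set x | S x /\ forall j, `|f (h j) x - (r j)%:R * e| < e].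
exists #|{ffun K -> 'I_q.+1}|, (fun i => V (enum_val i)); split; last first.
  move=> i x y [_ Vx] [_ Vy] j.
  have := Vx j; have := Vy j; set z := _%:R * e.
  rewrite !ltr_norml => /andP[y1 y2] /andP[x1 x2]; rewrite ler_norml; apply/andP; split; lra.
split=> [i|x Sx].
  split=> [x []//|x [Sx Vx]].
  (* [dl j] is the slack left in coordinate [j]; the minimum of all slacks, capped at 1, is a radius
     of openness. *)
  pose dl j := e - `|f (h j) x - ((enum_val i : {ffun _ -> _}) j)%:R * e|.
  exists #|K|, (fun j => h (enum_val j)), (\big[Order.min/1]_j dl j); split; last split=> //.
    by apply: lt_bigmin => // j _; rewrite subr_gt0.
  move=> y Sy fy; split=> // j.
  have := fy (enum_rank j); rewrite enum_rankK => fyj.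
  have /(lt_le_trans fyj) : \big[Order.min/1]_j dl j <= dl j by exact: bigmin_le.
  rewrite /dl ltrBrDr; apply: le_lt_trans.
  by rewrite (le_trans _ (ler_normD _ _))// addrA subrK.
have fq j : (Num.truncn (f (h j) x / e) < q.+1)%N.
  rewrite ltnS le_truncn// ler_pdivrMr// mulVf ?gt_eqF//.
  by have /andP[] := f01 j Sx.
exists (enum_rank [ffun j => Ordinal (fq j)]); rewrite enum_rankK; split=> // j.
rewrite ffunE /=; have /andP[f0 _] := f01 j Sx.
have /truncn_itv : 0 <= f (h j) x / e by rewrite divr_ge0// ltW.
rewrite ler_pdivlMr// ltr_pdivrMr// -natr1 mulrDl mul1r => /andP[l1 l2].
by rewrite ger0_norm ?subr_ge0// ltrBlDl.
Qed.

End FineCover.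

(** Jensen's inequality, by the tangent line of the exponential at [m]. *)
Lemma mean_expR_ge (R : realType) (I : finType) (F : I -> R) (m : R) :
  #|I|%:R * m <= \sum_i F i -> #|I|%:R * expR m <= \sum_i expR (F i).
Proof.
move=> mF; apply: (@le_trans _ _ (\sum_i expR m * (1 + (F i - m)))).
  rewrite -mulr_sumr big_split sumrB !sumr_const /= -[m *+ _]mulr_natl [leLHS]mulrC.
  by apply: ler_wpM2l; rewrite ?expR_ge0// lerDl subr_ge0.
apply: ler_sum => i _; have -> : expR (F i) = expR m * expR (F i - m).
  by rewrite -expRD addrC subrK.
by rewrite ler_wpM2l ?expR_ge0// expR_ge1Dx.
Qed.

Section Counting.
Variables (R : realType) (d : measure_display) (X : measurableType d).
Variables (mu : probability X R) (T : X -> X).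
Hypothesis mT : measurable_fun setT T.
Hypothesis muT : forall A, measurable A -> mu (T @^-1` A) = mu A.
Variables (C : finType) (c : X -> C).
Hypothesis mc : forall i, measurable [set x | c x = i].
Notation cyl := (cyl T c).
Notation letter := (letter T c).
Notation wprob := (wprob mu T c).
Notation tcorr := (tcorr T c).
Notation phi := (@lens_map R d X T).
Variable g : C -> R.
Hypothesis g2 : forall a, g a ^+ 2 = 1.
Variables (v : R) (L : nat) (M lam e : R).
Hypothesis v0 : 0 < v.
Hypothesis gv : forall n, v <= cvar wprob g n.
Hypothesis wprobM : forall w, size w = L -> wprob w <= M.
Hypothesis lam0 : 0 < lam.
Hypothesis lamM : lam * M <= 1 / 2.
Variables (k : nat) (U : 'I_k -> set (set (X * X) -> \bar R)).
Hypothesis U_fine : forall i rho rho', U i rho -> U i rho' ->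
  \sum_(w : L.-tuple C) `|tcorr g rho w - tcorr g rho' w| <= e.

Lemma iter_lens_coupling j rho : couplings mu rho -> couplings mu (iter j phi rho).
Proof. by move=> crho; elim: j => //= j; exact: lens_map_coupling. Qed.

(** Apply [sum_expR_signs] to [lam] times the correlations. Each is at most
    [lam * wprob w <= lam * M], so the squares at one time sum to at most [lam ^+ 2 * M], because
    the word probabilities sum to 1. *)
Lemma avg_exp_tcorr n rho : couplings mu rho ->
  \sum_(s : {ffun 'I_n -> {ffun L.-tuple C -> bool}})
    expR (lam * \sum_(j < n) \sum_(w : L.-tuple C)
       sgb (s j w) * tcorr g (iter j phi rho) w) <=
  #|{ffun 'I_n -> {ffun L.-tuple C -> bool}}|%:R * expR (2 * lam ^+ 2 * M * n%:R).
Proof.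
move=> crho.
pose t (j : 'I_n) (w : L.-tuple C) := lam * tcorr g (iter j phi rho) w.
have tb j w : `|t j w| <= lam * wprob w.
  rewrite normrM (gtr0_norm lam0) ler_wpM2l ?(ltW lam0)//.
  by apply: (tcorr_norm mT mc g2); exact: iter_lens_coupling.
have tM j w : `|t j w| <= lam * M.
  by rewrite (le_trans (tb j w))// ler_wpM2l ?(ltW lam0)// wprobM// size_tuple.
rewrite (eq_bigr (fun s : {ffun 'I_n -> {ffun L.-tuple C -> bool}} =>
   expR (\sum_j \sum_w sgb (s j w) * t j w))); last first.
  move=> s _; congr expR; rewrite mulr_sumr; apply: eq_bigr => j _.
  by rewrite mulr_sumr; apply: eq_bigr => w _; rewrite mulrCA.
apply: (le_trans (sum_expR_signs _)).
  by move=> j w; rewrite (le_trans (tM j w)).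
rewrite ler_wpM2l// ler_expR.
have sq (j : 'I_n) : \sum_w t j w ^+ 2 <= lam ^+ 2 * M.
  apply: (@le_trans _ _ (\sum_(w : L.-tuple C) (lam * M) * (lam * wprob w))).
    apply: ler_sum => w _; rewrite -real_normK ?num_real// expr2.
    by rewrite ler_pM.
  rewrite -mulr_sumr -mulr_sumr -/(wsum L wprob).
  rewrite (wsum_p (wprob_nil mu T c) (wprob_cons mT muT mc)) mulr1.
  by rewrite le_eqVlt; apply/orP; left; apply/eqP; ring.
have : \sum_j \sum_w t j w ^+ 2 <= \sum_(j < n) (lam ^+ 2 * M) by apply: ler_sum => j _.
by rewrite sumr_const card_ord -[(lam ^+ 2 * M) *+ n]mulr_natr; lra.
Qed.

(** The exponential sum of the self-correlations [S s] is large by Jensen. Split by the cell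
    containing [rho s], each cell contributes little, so there must be many cells. *)
Lemma covering_lower_bound n A : join_covering (couplings mu) phi U A ->
  expR ((lam * (v ^+ 2 / 4 - e) - 2 * lam ^+ 2 * M) * n%:R) <= (#|A : {set {ffun 'I_n -> 'I_k}}|)%:R :> R.
Proof.
move=> cA.
pose SS := {ffun 'I_n -> {ffun L.-tuple C -> bool}}.
pose N : R := #|SS|%:R.
have N0 : 0 < N by rewrite ltr0n; apply/card_gt0P; exists [ffun=> [ffun=> false]].
have /choice [rho Hrho] : forall s : SS, exists rho, couplings mu rho /\
  forall j : 'I_n, \sum_(w : L.-tuple C) sgf R s j w * tcorr g (iter j phi rho) w =
     riesz_corr wprob g s j.
  by move=> s; have [r cr rE] := riesz_coupling mT muT mc g2 s; exists r.
have /choice [al Hal] : forall s : SS, exists w, w \in A /\ join_cell phi U w (rho s).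
  by move=> s; have [w wA wc] := cA _ (Hrho s).1; exists w.
pose S (s : SS) := \sum_(j < n) riesz_corr wprob g s j.
have SE s : S s = \sum_(j < n) \sum_(w : L.-tuple C)
    sgb (s j w) * tcorr g (iter j phi (rho s)) w.
  apply: eq_bigr => j _; rewrite -(Hrho s).2; apply: eq_bigr => w _.
  by rewrite sgfE.
have lower : N * expR (lam * (v ^+ 2 / 4 * n%:R)) <= \sum_s expR (lam * S s).
  apply: mean_expR_ge; rewrite -mulr_sumr mulrCA ler_wpM2l ?(ltW lam0)//.
  rewrite /S exchange_big /=.
  under eq_bigr do rewrite (avg_riesz_corr (@wprob_ge0 _ _ _ mu T C c)
     (wprob_rcons mu mT mc) g2).
  rewrite -mulr_sumr ler_wpM2l//.
  rewrite (_ : _ * n%:R = \sum_(j < n) v ^+ 2 / 4); last first.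
    by rewrite sumr_const card_ord -[(v ^+ 2 / 4) *+ n]mulr_natr.
  apply: ler_sum => j _; rewrite ler_wpM2r// ler_pXn2r// ?nnegrE ?(ltW v0)//.
  exact: le_trans (ltW v0) (gv _).
pose B := expR (lam * e * n%:R) * expR (2 * lam ^+ 2 * M * n%:R).
have upper a : \sum_(s | al s == a) expR (lam * S s) <= N * B.
  (* Within one cell every [rho s] is replaced by a single [rho s0], at a cost of at most [e] per
     time step. By positivity the sum then extends to all [s], where [avg_exp_tcorr] applies. *)
  have [[s0 /eqP s0a]|nex] := pselect (exists s0, al s0 == a); last first.
    rewrite big1 ?mulr_ge0 ?expR_ge0 ?(ltW N0)// => s sa.
    by exfalso; apply: nex; exists s.
  apply: (@le_trans _ _ (\sum_(s : SS) expR (lam * e * n%:R) *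
     expR (lam * \sum_(j < n) \sum_(w : L.-tuple C)
       sgb (s j w) * tcorr g (iter j phi (rho s0)) w))); last first.
    rewrite -mulr_sumr /B mulrCA ler_wpM2l ?expR_ge0//.
    exact: avg_exp_tcorr (Hrho s0).1.
  rewrite big_mkcond; apply: ler_sum => s _; case: eqP => [sa|_]; last first.
    by rewrite mulr_ge0// expR_ge0.
  rewrite -expRD ler_expR -mulrA -mulrDr ler_wpM2l ?(ltW lam0)//.
  rewrite SE -lerBlDr -sumrB.
  rewrite (_ : e * n%:R = \sum_(j < n) e); last by rewrite sumr_const card_ord -[e *+ n]mulr_natr.
  apply: ler_sum => j _; rewrite -sumrB.
  have c1 := (Hal s).2 j; have c2 := (Hal s0).2 j.
  rewrite sa in c1; rewrite s0a in c2.
  apply: le_trans (U_fine c1 c2); apply: ler_sum => w _; rewrite -mulrBr.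
  by rewrite (le_trans (ler_norm _))// normrM norm_sgb mul1r.
have tot : \sum_s expR (lam * S s) <= #|A|%:R * (N * B).
  rewrite (partition_big al (mem A)) /=; last by move=> s _; exact: (Hal s).1.
  apply: (@le_trans _ _ (\sum_(a in A) N * B)); first by apply: ler_sum.
  by rewrite sumr_const -[(N * B) *+ _]mulr_natl.
have := le_trans lower tot; rewrite [leRHS]mulrCA ler_pM2l// => H.
rewrite (_ : _ * n%:R = lam * (v ^+ 2 / 4 * n%:R) -
   (lam * e * n%:R + 2 * lam ^+ 2 * M * n%:R)); last by ring.
by rewrite expRB expRD ler_pdivrMr// mulr_gt0// expR_gt0.
Qed.

End Counting.

(** * Entropy of a partition as entropy of words *)

Section JoinEntropy.
Variables (R : realType) (d : measure_display) (X : measurableType d).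
Variables (mu : probability X R) (T : X -> X) (k : nat) (Q : 'I_k -> set X).
Variable c : X -> 'I_k.
Hypothesis cQ : forall i x, Q i x <-> c x = i.

Lemma join_entropyE n : join_entropy mu T Q n = wentropy (wprob mu T c) n.
Proof.
congr (- _); rewrite /wsum.
rewrite (reindex (fun t : n.-tuple 'I_k => [ffun i => tnth t i])) /=; last first.
  exists (fun w : {ffun 'I_n -> 'I_k} => mktuple w) => [t _|w _].
    by apply: eq_from_tnth => i; rewrite tnth_mktuple ffunE.
  by apply/ffunP => i; rewrite ffunE tnth_mktuple.
apply: eq_bigr => t _; congr (xlnx (fine (mu _))).
apply/seteqP; split => x; rewrite /part_join /cyl /= size_tuple.
  move=> H; apply: (@eq_from_nth _ (c x)); rewrite size_name ?size_tuple// => i lti.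
  have := H (Ordinal lti); rewrite ffunE => /cQ /= H1.
  by rewrite nth_mkseq// H1 (tnth_nth (c x)).
move=> H j; apply/cQ; rewrite ffunE (tnth_nth (c x)) -H nth_mkseq//.
Qed.

End JoinEntropy.

(** * Choice of parameters and conclusion *)

Section InfiniteEntropy.
Variables (R : realType) (d : measure_display) (X : measurableType d).
Variables (mu : probability X R) (T : X -> X).
Hypothesis mT : measurable_fun setT T.
Hypothesis muT : forall A, measurable A -> mu (T @^-1` A) = mu A.
Hypothesis ergT : ergodic mu T.
Variables (C : finType) (c : X -> C).
Hypothesis mc : forall i, measurable [set x | c x = i].
Variables (g : C -> R) (v : R).
Hypothesis g2 : forall a, g a ^+ 2 = 1.
Hypothesis v0 : 0 < v.
Hypothesis gv : forall n, v <= cvar (wprob mu T c) g n.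

(** The empty Riesz product is the constant density 1, which gives the product coupling. *)
Lemma couplings_neq0 : couplings mu !=set0.
Proof.
have [rho crho _] := riesz_coupling mT muT mc g2
  ([ffun=> [ffun=> false]] : {ffun 'I_0 -> {ffun 0.-tuple C -> bool}}).
by exists rho.
Qed.

Lemma tcorr_fine_cover L (e : R) : 0 < e ->
  exists k (U : 'I_k -> set (set (X * X) -> \bar R)),
    open_cover (@coord_index _ X) (@coupling_coord R d X) (couplings mu) U /\
    forall i rho rho', U i rho -> U i rho' ->
      \sum_(w : L.-tuple C) `|tcorr T c g rho w - tcorr T c g rho' w| <= e.
Proof.
move=> e0.
pose K : finType := (L.-tuple C * (C * C))%type.
pose h (z : K) : set X * set X :=
  (letter T c (size z.1) z.2.1, cyl T c (rcons z.1 z.2.2)).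
have hJ z : coord_index (h z).
  by split; [exact: measurable_letter | exact: measurable_cyl].
have f01 z rho : couplings mu rho -> 0 <= coupling_coord (h z) rho <= 1.
  have [m1 m2] := hJ z.
  move=> [m [-> _]]; rewrite /coupling_coord fine_ge0//= -lee_fin fineK.
    by rewrite probability_le1//; exact: measurableX.
  by rewrite fin_num_measure//; exact: measurableX.
(* Each of the [#|K|] coordinates varies by at most [2 * e1] on a cell; the added 1 keeps the
   denominator positive. *)
pose e1 := e / (2 * (#|K|%:R + 1)).
have K1 : 0 < #|K|%:R + 1 :> R by rewrite ltr_wpDl.
have e10 : 0 < e1 by rewrite divr_gt0// mulr_gt0.
have [k [U [Uo Uf]]] := fine_cover hJ f01 e10.
exists k, U; split=> // i rho rho' Ur Ur'.
apply: (@le_trans _ _ (\sum_(z : K) 2 * e1)).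
  rewrite -(pair_bigA _ (fun (_ : L.-tuple C) (_ : C * C) => 2 * e1)) /=.
  apply: ler_sum => w _.
  rewrite -(pair_bigA _ (fun (_ : C) (_ : C) => 2 * e1)) /= /tcorr -sumrB.
  rewrite (le_trans (ler_norm_sum _ _ _))// ler_sum// => a _; rewrite -sumrB.
  rewrite (le_trans (ler_norm_sum _ _ _))// ler_sum// => b _; rewrite -mulrBr.
  rewrite 2!normrM !(norm_g g2) !mul1r.
  exact: (Uf i _ _ Ur Ur' (w, (a, b))).
rewrite sumr_const -[(2 * e1) *+ _]mulr_natl.
rewrite (_ : _ * _ = e * (#|K|%:R / (#|K|%:R + 1))); last first.
  by rewrite /e1; field; rewrite gt_eqF.
by rewrite ger_pMr// ler_pdivrMr// mul1r lerDl.
Qed.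

Lemma top_entropy_lens_infty :
  top_entropy (@coord_index _ X) (@coupling_coord R d X) (couplings mu) (lens_map T)
  = +oo%E.
Proof.
apply/eqyP => B B0.
have v2 : 0 < v ^+ 2 / 8 by rewrite divr_gt0// exprn_gt0.
(* With the cover of fineness [v ^+ 2 / 8], the gain [lam * (v ^+ 2 / 4 - v ^+ 2 / 8)] equals
   [B + 1]. The choice of [M] below keeps the loss [2 * lam ^+ 2 * M] at most 1 and also ensures
   [lam * M <= 1 / 2]. *)
pose lam := (B + 1) / (v ^+ 2 / 8).
have lam0 : 0 < lam by rewrite divr_gt0// addr_gt0.
pose M := 1 / (2 * (lam + 1) ^+ 2).
have l1 : 0 < lam + 1 by rewrite addr_gt0.
have l2 : 0 < (lam + 1) ^+ 2 by rewrite exprn_gt0.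
have M0 : 0 < M by rewrite divr_gt0// mulr_gt0.
have lamM : lam * M <= 1 / 2.
  rewrite /M mulrA mulr1 ler_pdivrMr ?mulr_gt0//; nra.
have lam2M : 2 * lam ^+ 2 * M <= 1.
  rewrite /M mulrA mulr1 ler_pdivrMr ?mulr_gt0//; nra.
have [L wM] := small_atoms mT muT ergT mc g2 v0 gv M0.
have [k [U [Uo Uf]]] := tcorr_fine_cover L v2.
apply: (@le_trans _ _ (cover_entropy R (couplings mu) (lens_map T) U)%:E); last first.
  by apply: ereal_sup_ubound; exists k, U.
rewrite lee_fin; apply: cover_entropy_ge.
- exact: lens_map_coupling.
- by case: Uo.
- exact: couplings_neq0.
- move=> n A cA.
  apply: le_trans (covering_lower_bound mT muT mc g2 v0 gv wM lam0 lamM Uf cA).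
  rewrite ler_expR ler_wpM2r//.
  have : lam * (v ^+ 2 / 4 - v ^+ 2 / 8) = B + 1.
    rewrite (_ : v ^+ 2 / 4 - v ^+ 2 / 8 = v ^+ 2 / 8); last by field.
    by rewrite /lam divfK// gt_eqF.
  by lra.
Qed.

End InfiniteEntropy.

Theorem mainTheorem15 (R : realType) (d : measure_display) (X : measurableType d)
  (mu : probability X R) (T : X -> X) :
  standard_borel R X ->
  is_aut mu T -> ergodic mu T -> (0 < ks_entropy mu T)%E ->
  top_entropy (@coord_index _ X) (@coupling_coord R d X) (couplings mu) (lens_map T)
  = (+oo)%E.
Proof.
move=> _ [_ [mT [_ muT]]] ergT /ereal_sup_gt[_ [k [Q [[mQ [dQ covQ]] ->]]]].
rewrite lte_fin => hQ.
(* The partition becomes a letter map [c], so that its joins are the cylinders of names. *)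
have /choice [c cP] : forall x, exists i, Q i x by [].
have cQ i x : Q i x <-> c x = i.
  split=> [Qix|<-//]; apply/eqP/negPn/negP => ci.
  have : (Q (c x) `&` Q i) x by [].
  by rewrite dQ.
have mc i : measurable [set x | c x = i].
  by rewrite [X in measurable X](_ : _ = Q i)//; apply/seteqP; split=> x /cQ.
have hw : 0 < limn (fun n => wentropy (wprob mu T c) n.+1 / n.+1%:R).
  suff <- : (fun n => join_entropy mu T Q n.+1 / n.+1%:R) =
      (fun n => wentropy (wprob mu T c) n.+1 / n.+1%:R) by [].
  by apply/funext => n; rewrite (join_entropyE mu T cQ).
have [i [v [v0 gv]]] := cvar_lower_bound (@wprob_ge0 _ _ _ mu T _ c) (wprob_nil mu T c)
  (wprob_rcons mu mT mc) (wprob_cons mT muT mc) hw.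
exact: (top_entropy_lens_infty mT muT ergT mc (pm1_sqr R i) v0 gv).
Qed.
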